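(* There is a universal constant $c>0$ such that the following holds. Let $S=\{(x_i,y_i)\}_{i=1}^n\subset X\times Y$, let $\{h_w:w\in\mathbb R^m\}$ be a parameterized class of functions (neural networks) $h_w:X\to\mathbb R^C$, and let $\Theta:=\{w\in\mathbb R^m:\|w\|_2\le R\}$. Fix $\sigma>0$ and let $\mathcal F_\sigma$ be the Jensen gap class for the loss function $L(h_w(x),y)$ (defined in the context). Assume that for each $y$, the map $z\mapsto L(z,y)$ is differentiable, $\ell$-Lipschitz and $\beta$-smooth. Let $u\sim\mathcal N(0,I_m)$ and assume moreover that, for each $i\in\{1,\dots,n\}$: (1) the map $w\mapsto h_w(x_i)$ is twice continuously differentiable on $\mathbb R^m$, and the Gaussian expectations below and $\mathbb E_u[L(h_{w+\sigma u}(x_i),y_i)]$ are finite, the latter being differentiable in $w$ under the expectation sign; write $J_i(w):=\nabla_wh_w(x_i)\in\mathbb R^{C\times m}$ and $H_{i,k}(w):=\nabla_w^2(h_w(x_i))_k\in\mathbb R^{m\times m}$; (2) there is a sample-dependent matrix $G_i\succeq0$ with $J_i(w)^\top J_i(w)\preceq G_i$ for all $w\in\Theta$; (3) $A_{i,\sigma}:=\sup_{w\in\Theta}\int_0^1\mathbb E_u\big[u^\top J_i(w+t\sigma u)^\top J_i(w+t\sigma u)u\big]dt<\infty$; (4) there is a sample-dependent matrix $B_{i,\sigma}\succeq0$ such that, for all $w\in\Theta$, $$\int_0^1\mathbb E_u\Big[\sum_{k=1}^CH_{i,k}(w+t\sigma u)^\top uu^\top H_{i,k}(w+t\sigma u)\Big]dt\preceq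 B_{i,\sigma}.$$ Define $$J_{S,\sigma}:=\frac1n\sum_{i=1}^nA_{i,\sigma}\operatorname{Trace}(G_i),\qquad H_{S,\sigma}:=\frac1n\sum_{i=1}^n\operatorname{Trace}(B_{i,\sigma}).$$ Then, the empirical Rademacher complexity of $\mathcal F_\sigma$ satisfies $$\mathfrak R_S(\mathcal F_\sigma)\le c\,\frac{R\sigma}{\sqrt n}\sqrt{\beta^2J_{S,\sigma}+\ell^2H_{S,\sigma}}.$$
   Context: The Jensen gap class is $\mathcal F_\sigma:=\{(x,y)\mapsto L(h_w(x),y)-\mathbb E_{u\sim\mathcal N(0,I_m)}[L(h_{w+\sigma u}(x),y)]:w\in\Theta\}$. The empirical Rademacher complexity of a class $\mathcal F$ of real functions on $X\times Y$ is $\mathfrak R_S(\mathcal F):=\frac1n\mathbb E_\varepsilon\big[\sup_{f\in\mathcal F}\sum_{i=1}^n\varepsilon_if(x_i,y_i)\big]$ with $\varepsilon_1,\dots,\varepsilon_n$ independent Rademacher ($\pm1$) variables. A map is $\beta$-smooth if it is differentiable with $\beta$-Lipschitz gradient (Euclidean norm). *)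

(* Defs.v *)
From HB Require Import structures.
From mathcomp Require Import all_boot all_order all_algebra.
From mathcomp Require Import all_classical all_reals all_analysis.

Set Implicit Arguments.
Unset Strict Implicit.
Unset Printing Implicit Defensive.
Import Order.TTheory GRing.Theory Num.Theory.
Import numFieldNormedType.Exports.

Local Open Scope classical_set_scope.
Local Open Scope ring_scope.

(* Vectors of R^k are row vectors
   'rV[R]_k, so a quadratic form v^T A v reads v *m A *m v^T and the matrix
   v v^T reads v^T *m v. *)

(* The norm that the library puts on matrices is the sup norm; it is only used
   here through differentiability and continuity, which do not depend on the
   choice of a norm. *)
Definition enorm (R : realType) k (v : 'rV[R]_k) : R :=
  Num.sqrt (\sum_j v ord0 j ^+ 2).

Definition psd (R : realType) k (A : 'M[R]_k) : Prop :=
  A^T = A /\ forall v : 'rV[R]_k, 0 <= (v *m A *m v^T) ord0 ord0.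

Definition loewner_le (R : realType) k (A B : 'M[R]_k) : Prop := psd (B - A).

Definition grad (R : realType) k (f : 'rV[R]_k -> R) (w : 'rV[R]_k) : 'rV[R]_k :=
  \row_j 'd f w (delta_mx ord0 j).

(* The library's 'J f w acts on row vectors from the right (entry (j, k) is the
   j-th partial derivative of the k-th component), hence the transpose. *)
Definition jac (R : realType) m C (f : 'rV[R]_m -> 'rV[R]_C) (w : 'rV[R]_m) :
  'M[R]_(C, m) := ('J f w)^T.

Definition hess (R : realType) m (f : 'rV[R]_m -> R) (w : 'rV[R]_m) : 'M[R]_m :=
  jac (grad f) w.

Definition class_C2 (R : realType) m C (f : 'rV[R]_m -> 'rV[R]_C) : Prop :=
  [/\ forall w, differentiable f w,
      forall w, differentiable (jac f) w &
      forall v, continuous (fun w => 'd (jac f) w v)].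

Definition lipschitz2 (R : realType) k p (l : R) (f : 'rV[R]_k -> 'rV[R]_p) :
    Prop :=
  forall z z', enorm (f z - f z') <= l * enorm (z - z').

Definition lipschitz2_real (R : realType) k (l : R) (f : 'rV[R]_k -> R) : Prop :=
  forall z z', `|f z - f z'| <= l * enorm (z - z').

Definition smooth (R : realType) k (b : R) (f : 'rV[R]_k -> R) : Prop :=
  (forall z, differentiable f z) /\ lipschitz2 b (grad f).

(* Entrywise integration of matrix-valued functions. *)
Definition mx_integrable (R : realType) d (T : measurableType d)
    (mu : {measure set T -> \bar R}) (D : set T) p q (M : T -> 'M[R]_(p, q)) :
    Prop :=
  forall a b, mu.-integrable D (fun t => (M t a b)%:E).

Definition mx_integral (R : realType) d (T : measurableType d)
    (mu : {measure set T -> \bar R}) (D : set T) p q (M : T -> 'M[R]_(p, q)) :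
    'M[R]_(p, q) :=
  \matrix_(a, b) \int[mu]_(t in D) M t a b.

(* u ~ N(0, I_m): the coordinates are jointly independent standard normal
   variables (taking some A j to be the full set gives every subfamily). *)
Definition std_gaussian (R : realType) d (T : measurableType d)
    (P : probability T R) m (u : T -> 'rV[R]_m) : Prop :=
  (forall j, measurable_fun [set: T] (fun t => u t ord0 j)) /\
  forall A : 'I_m -> set R, (forall j, measurable (A j)) ->
    P [set t | forall j, A j (u t ord0 j)] =
    (\prod_(j < m) normal_prob 0 1 (A j))%E.

(* Expectation over n independent fair signs, i.e. the average over {-1, 1}^n.
   The supremum is taken in \bar R, so that an unbounded class has complexity
   +oo (the real-valued sup would return 0). *)
Definition rademacher_complexity (R : realType) (Z : Type) n (S : 'I_n -> Z)
    (F : set (Z -> R)) : \bar R :=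
  ((n%:R^-1)%:E *
   (((2 ^ n)%:R^-1)%:E *
    \sum_(e : {ffun 'I_n -> bool})
      ereal_sup [set (\sum_(i < n) (-1) ^+ e i * f (S i))%:E | f in F]))%E.

Definition eball (R : realType) m (rho : R) : set 'rV[R]_m :=
  [set w | enorm w <= rho].

Section jensen_gap.
Context (R : realType) (d : measure_display) (T : measurableType d).
Context (P : probability T R) (m C : nat) (u : T -> 'rV[R]_m) (sigma : R).

Definition smoothed (f : 'rV[R]_m -> R) (w : 'rV[R]_m) : R :=
  \int[P]_t f (w + sigma *: u t).

Definition jensen_gap_class (X Y : Type) (h : 'rV[R]_m -> X -> 'rV[R]_C)
    (L : 'rV[R]_C -> Y -> R) (Theta : set 'rV[R]_m) : set (X * Y -> R) :=
  [set (fun p : X * Y =>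
          L (h w p.1) p.2 - smoothed (fun w' => L (h w' p.1) p.2) w)
  | w in Theta].

(* E_u[f(w + sigma u)] is finite and differentiable at w under the expectation
   sign. *)
Definition differentiable_under_expectation (f : 'rV[R]_m -> R)
    (w : 'rV[R]_m) : Prop :=
  [/\ P.-integrable [set: T] (fun t => (f (w + sigma *: u t))%:E),
      differentiable (smoothed f) w,
      mx_integrable P [set: T] (fun t => grad f (w + sigma *: u t)) &
      grad (smoothed f) w =
        mx_integral P [set: T] (fun t => grad f (w + sigma *: u t))].

(* u^T J(w + s sigma u)^T J(w + s sigma u) u *)
Definition jac_form (f : 'rV[R]_m -> 'rV[R]_C) (w : 'rV[R]_m) (s : R) (t : T) :
    R :=
  let J := jac f (w + (s * sigma) *: u t) in
  (u t *m (J^T *m J) *m (u t)^T) ord0 ord0.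

(* sum_k H_k(w + s sigma u)^T u u^T H_k(w + s sigma u) *)
Definition hess_form (f : 'rV[R]_m -> 'rV[R]_C) (w : 'rV[R]_m) (s : R) (t : T) :
    'M[R]_m :=
  \sum_(k < C)
    let H := hess (fun w' => f w' ord0 k) (w + (s * sigma) *: u t) in
    H^T *m ((u t)^T *m u t) *m H.

Definition jac_sup (f : 'rV[R]_m -> 'rV[R]_C) (Theta : set 'rV[R]_m) : \bar R :=
  ereal_sup [set (\int[lebesgue_measure]_(s in `[0%R, 1%R]) 'E_P[jac_form f w s])%E
            | w in Theta].

End jensen_gap.

(* Main.v *)
(* Let [phi_i w] be the Jensen gap at the [i]-th sample.  Differentiating under
   the expectation and using the chain rule, the derivative of [phi_i] in the
   direction [v] is the mean of
     <grad L(h_w) - grad L(h_(w + sigma u)), J(w) v>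
       - <grad L(h_(w + sigma u)), (J(w + sigma u) - J(w)) v>.
   The increments of [h] and of [J] along the segment from [w] to [w + sigma u]
   are integrals of [sigma J u] and [sigma u^T H_k v], so Cauchy-Schwarz, Jensen
   and Tonelli bound its square by the quadratic form of
     Sig_i = 2 sigma^2 (b^2 A_i G_i + l^2 B_i)
   at [v].  By the mean value theorem, [phi_i] is thus 1-Lipschitz for the
   seminorm [v |-> |Sig_i^(1/2) v|].

   Writing [Sig_i = F_i^T F_i], Khintchine's inequality dominates this seminorm
   by the mean of [|<xi, v>|], where [xi] is twice a random signed sum of the rows
   of [F_i].  Maurer's vector contraction principle then replaces each
   [eps_i phi_i(w)], one index at a time, by the linear process [<xi_i, w>],
   whose supremum over the ball of radius [rho] has mean at most
   [2 rho (sum_i tr Sig_i)^(1/2)].  This gives [c = 2 sqrt 2].  A chaining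
   argument through entropy numbers would lose a logarithm here. *)

Require Import Defs.
From HB Require Import structures.
From mathcomp Require Import all_boot all_order all_algebra.
From mathcomp Require Import all_classical all_reals all_analysis.
From mathcomp Require Import measurable_realfun ring lra.

Set Implicit Arguments.
Unset Strict Implicit.
Unset Printing Implicit Defensive.
Import Order.TTheory GRing.Theory Num.Theory.
Import numFieldNormedType.Exports.

Local Open Scope classical_set_scope.
Local Open Scope ring_scope.

(** * Rademacher averages and vector contraction *)

Section Averages.
Context {R : realType}.

Definition mean (I : finType) (F : I -> R) : R := #|I|%:R^-1 * \sum_i F i.

Lemma ler_mean (I : finType) (F G : I -> R) :
  (forall i, F i <= G i) -> mean F <= mean G.
Proof.
by move=> FG; rewrite ler_wpM2l ?invr_ge0 ?ler0n//; apply: ler_sum => i _.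
Qed.

Lemma eq_mean (I : finType) (F G : I -> R) : F =1 G -> mean F = mean G.
Proof. by move=> FG; rewrite /mean (eq_bigr G). Qed.

Lemma meanD (I : finType) (F G : I -> R) :
  mean (fun i => F i + G i) = mean F + mean G.
Proof. by rewrite /mean big_split mulrDr. Qed.

Lemma meanZ (I : finType) (c : R) (F : I -> R) :
  mean (fun i => c * F i) = c * mean F.
Proof. by rewrite /mean -mulr_sumr mulrCA. Qed.

Lemma mean_sum (I J : finType) (F : I -> J -> R) :
  mean (fun i => \sum_j F i j) = \sum_j mean (F ^~ j).
Proof. by rewrite /mean exchange_big mulr_sumr. Qed.

Lemma mean_exchange (I J : finType) (F : I -> J -> R) :
  mean (fun i => mean (F i)) = mean (fun j => mean (F ^~ j)).
Proof. by rewrite /mean -!mulr_sumr mulrCA exchange_big. Qed.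

Lemma mean_cst (I : finType) (i0 : I) (c : R) : mean (fun _ : I => c) = c.
Proof.
rewrite /mean sumr_const -[c *+ _]mulr_natl mulrA mulVf ?mul1r//.
by rewrite pnatr_eq0 -lt0n; apply/card_gt0P; exists i0.
Qed.

Lemma mean_inv (I : finType) (s : I -> I) (F : I -> R) :
  involutive s -> mean F = mean (F \o s).
Proof.
move=> sK; rewrite /mean [in LHS](reindex_inj (inv_inj sK)).
by congr (_ * _); apply: eq_bigr.
Qed.

(** Pairing each point with its image plays the role of conditioning: with [s] a sign flip, terms
    odd in that sign cancel within each pair. *)
Lemma mean_sym (I : finType) (s : I -> I) (F : I -> R) :
  involutive s -> mean F = mean (fun i => (F i + F (s i)) / 2).
Proof.
move=> sK; rewrite -[LHS](mulfK (_ : 2 != 0 :> R))// mulr2n mulrDr mulr1.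
rewrite {2}(mean_inv F sK) -meanD mulrC -meanZ.
by apply: eq_mean => i /=; rewrite mulrC.
Qed.

(** The difference of the two sides is the variance of [F]. *)
Lemma sqr_mean_le (I : finType) (i0 : I) (F : I -> R) :
  mean F ^+ 2 <= mean (fun i => F i ^+ 2).
Proof.
set c := mean F; rewrite -subr_ge0.
have -> : mean (fun i => F i ^+ 2) - c ^+ 2 = mean (fun i => (F i - c) ^+ 2).
  rewrite (@eq_mean _ (fun i => (F i - c) ^+ 2)
    (fun i => F i ^+ 2 + ((- 2 * c) * F i + c ^+ 2))); last by move=> i; ring.
  by rewrite !meanD meanZ (mean_cst i0) -/c; ring.
by rewrite mulr_ge0 ?invr_ge0// sumr_ge0// => i _; rewrite sqr_ge0.
Qed.

Lemma mean_sqrt_le (I : finType) (i0 : I) (F : I -> R) :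
  (forall i, 0 <= F i) -> mean (fun i => Num.sqrt (F i)) <= Num.sqrt (mean F).
Proof.
move=> F0; have m0 : 0 <= mean F by rewrite mulr_ge0 ?invr_ge0// sumr_ge0.
apply: le_trans (ler_norm _) _; rewrite -sqrtr_sqr ler_wsqrtr//.
apply: le_trans (sqr_mean_le i0 _) _; apply: ler_mean => i.
by rewrite sqr_sqrtr.
Qed.

End Averages.

(** * Moments of signed sums and Khintchine's inequality *)

Section Signs.
Context {R : realType} {n : nat}.
Implicit Types (e : {ffun 'I_n -> bool}) (i : 'I_n).

Definition sgnb e i : R := (-1) ^+ e i.

Definition flip i e : {ffun 'I_n -> bool} :=
  [ffun j => if j == i then ~~ e j else e j].

Definition flip_all e : {ffun 'I_n -> bool} := [ffun j => ~~ e j].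

Lemma flipK i : involutive (flip i).
Proof.
by move=> e; apply/ffunP => j; rewrite !ffunE; case: eqP => // _; rewrite negbK.
Qed.

Lemma flip_allK : involutive flip_all.
Proof. by move=> e; apply/ffunP => j; rewrite !ffunE negbK. Qed.

Lemma sgnb_flip i e j : j != i -> sgnb (flip i e) j = sgnb e j.
Proof. by rewrite /sgnb ffunE => /negbTE ->. Qed.

Lemma sgnb_flip_eq i e : sgnb (flip i e) i = - sgnb e i.
Proof. by rewrite /sgnb ffunE eqxx; case: (e i); rewrite ?expr0 ?expr1 ?opprK. Qed.

Lemma sgnb_flip_all e j : sgnb (flip_all e) j = - sgnb e j.
Proof. by rewrite /sgnb ffunE; case: (e j); rewrite ?expr0 ?expr1 ?opprK. Qed.

Lemma sqr_sgnb e i : sgnb e i ^+ 2 = 1.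
Proof. by rewrite /sgnb sqrr_sign. Qed.

Lemma sum_sgnb_flip i e (s : seq 'I_n) (a : 'I_n -> R) : i \notin s ->
  \sum_(j <- s) sgnb (flip i e) j * a j = \sum_(j <- s) sgnb e j * a j.
Proof.
move=> is_; rewrite !big_seq; apply: eq_bigr => j js; rewrite sgnb_flip//.
by apply: contraNneq is_ => <-.
Qed.

(** Induction on the list: the head index does not occur in the tail, so flipping its sign leaves
    the tail sum alone and cancels the cross term. *)
Lemma mean_sqr_sum_sgnb_seq (s : seq 'I_n) (a : 'I_n -> R) : uniq s ->
  mean (fun e => (\sum_(i <- s) sgnb e i * a i) ^+ 2) = \sum_(i <- s) a i ^+ 2.
Proof.
elim: s => [_|i s IH /= /andP[is_ us]].
  rewrite big_nil -[RHS](mean_cst [ffun _ : 'I_n => true]).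
  by apply: eq_mean => e; rewrite big_nil expr0n.
rewrite big_cons -IH// -[X in X + _](mean_cst [ffun _ : 'I_n => true]) -meanD.
rewrite (mean_sym _ (flipK i)); apply: eq_mean => e.
rewrite !big_cons sum_sgnb_flip// sgnb_flip_eq.
set x := \sum_(_ <- _) _.
transitivity (sgnb e i ^+ 2 * a i ^+ 2 + x ^+ 2); first by field.
by rewrite sqr_sgnb mul1r.
Qed.

Lemma mean_sqr_sum_sgnb (a : 'I_n -> R) :
  mean (fun e => (\sum_i sgnb e i * a i) ^+ 2) = \sum_i a i ^+ 2.
Proof. by rewrite mean_sqr_sum_sgnb_seq// index_enum_uniq. Qed.

(** Averaging [(x + a) ^+ 4] and [(x - a) ^+ 4] gives [x ^+ 4 + 6 * a ^+ 2 * x ^+ 2 + a ^+ 4]. With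
    [V] the second moment of the tail, the induction closes because
    [3 V^2 + 6 a^2 V + a^4 <= 3 (V + a^2)^2]. *)
Lemma mean_expr4_sum_sgnb_seq (s : seq 'I_n) (a : 'I_n -> R) : uniq s ->
  mean (fun e => (\sum_(i <- s) sgnb e i * a i) ^+ 4)
    <= 3 * (\sum_(i <- s) a i ^+ 2) ^+ 2.
Proof.
elim: s => [_|i s IH /= /andP[is_ us]].
  rewrite big_nil expr0n mulr0 -[leRHS](mean_cst [ffun _ : 'I_n => true]).
  by apply: ler_mean => e; rewrite big_nil expr0n.
rewrite (mean_sym _ (flipK i)).
rewrite (@eq_mean _ _ _ (fun e => (\sum_(j <- s) sgnb e j * a j) ^+ 4 +
   (6 * a i ^+ 2 * (\sum_(j <- s) sgnb e j * a j) ^+ 2 + a i ^+ 4))).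
  rewrite !meanD meanZ (mean_cst [ffun _ : 'I_n => true]) big_cons.
  rewrite mean_sqr_sum_sgnb_seq//; have := IH us; nra.
move=> e; rewrite !big_cons sum_sgnb_flip// sgnb_flip_eq.
set x := \sum_(_ <- _) _.
transitivity (x ^+ 4 + (6 * (sgnb e i ^+ 2 * a i ^+ 2) * x ^+ 2
   + (sgnb e i ^+ 2) ^+ 2 * a i ^+ 4)); first by field.
by rewrite sqr_sgnb mul1r expr1n mul1r.
Qed.

(** The second moment [s ^+ 2] and the bound [3 * s ^+ 4] on the fourth moment give
    [9 s^4 <= 16 s^3 X], where [X] is the first absolute moment. Hence [s <= (16/9) X], and the
    constant is rounded up to 2. *)
Lemma khintchine (a : 'I_n -> R) :
  Num.sqrt (\sum_i a i ^+ 2) <= 2 * mean (fun e => `|\sum_i sgnb e i * a i|).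
Proof.
set v := \sum_i a i ^+ 2.
have v0 : 0 <= v by apply: sumr_ge0 => i _; rewrite sqr_ge0.
set s := Num.sqrt v; have [s0|s0] := leP s 0.
  apply: (le_trans s0); rewrite mulr_ge0// mulr_ge0 ?invr_ge0//.
  by apply: sumr_ge0.
have vE : v = s ^+ 2 by rewrite sqr_sqrtr.
(* [(t - 2) ^ 2 * (t + 4) >= 0] at [t = |x| / s], so that [|x|] is bounded below
   by a combination of the second and fourth powers of [x]. *)
have pt x : 12 * s ^+ 2 * x ^+ 2 - x ^+ 4 <= 16 * s ^+ 3 * `|x|.
  rewrite -[x ^+ 2]real_normK ?num_real// (_ : x ^+ 4 = `|x| ^+ 4); last first.
    by rewrite -normrX ger0_norm// (exprM x 2 2) sqr_ge0.
  have y0 := normr_ge0 x; move: `|x| y0 => y y0; rewrite -subr_ge0.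
  have -> : 16 * s ^+ 3 * y - (12 * s ^+ 2 * y ^+ 2 - y ^+ 4) =
     y * ((y - 2 * s) ^+ 2 * (y + 4 * s)) by ring.
  by rewrite mulr_ge0// mulr_ge0 ?sqr_ge0// addr_ge0// mulr_ge0// ltW.
set X := mean _.
have : mean (fun e => 12 * s ^+ 2 * (\sum_i sgnb e i * a i) ^+ 2 +
                      (-1) * (\sum_i sgnb e i * a i) ^+ 4) <= 16 * s ^+ 3 * X.
  by rewrite -meanZ; apply: ler_mean => e; rewrite mulN1r.
rewrite meanD !meanZ mean_sqr_sum_sgnb -/v vE mulN1r.
have := mean_expr4_sum_sgnb_seq a (index_enum_uniq 'I_n).
rewrite -/v vE => h4 h.
have {h4}h : 9 * s ^+ 4 <= 16 * s ^+ 3 * X by lra.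
have : s ^+ 3 * (9 * s) <= s ^+ 3 * (16 * X) by nra.
by rewrite ler_pM2l ?exprn_gt0//; lra.
Qed.

End Signs.

(** * Finite maxima and the one-coordinate contraction *)

Section FiniteMax.
Context {R : realType} {I : finType} (i0 : I).

(** Defined through the maximizer, which the contraction argument has to name. The index type will
    be the set of sign patterns, one point of the ball being selected for each. *)
Definition fmax (F : I -> R) : R := F [arg max_(i > i0) F i]%O.

Lemma le_fmax (F : I -> R) i : F i <= fmax F.
Proof. by rewrite /fmax; case: arg_maxP => // j _; apply. Qed.

Lemma fmax_le (F : I -> R) c : (forall i, F i <= c) -> fmax F <= c.
Proof. exact. Qed.

(* Evaluate at the two maximizers: bounding the increment of [phi] by that of [g]
   leaves an absolute value, which may be dropped because the bound is symmetric
   in the two points. *)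
Lemma fmax_contraction (J : finType) (w0 : J) (neg : J -> J) (g : J -> I -> R)
    (psi phi : I -> R) :
  involutive neg -> (forall w i, g (neg w) i = - g w i) ->
  (forall i j, `|phi i - phi j| <= mean (fun w => `|g w i - g w j|)) ->
  fmax (fun i => psi i + phi i) + fmax (fun i => psi i - phi i)
    <= 2 * mean (fun w => fmax (fun i => psi i + g w i)).
Proof.
move=> negK gneg phig; pose Mx s := fmax (fun i => psi i + s i).
set a := [arg max_(i > i0) (psi i + phi i)]%O.
set b := [arg max_(i > i0) (psi i - phi i)]%O.
rewrite /(fmax (fun i => psi i + phi i)) /(fmax (fun i => psi i - phi i)) -/a -/b.
(* Since [neg] reverses the sign of [g], the mean splits into equal contributions of [g] and [- g],
   matching the two maxima on the left. *)
have -> : mean (fun w => fmax (fun i => psi i + g w i)) =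
    mean (fun w => (Mx (g w) + Mx (fun i => - g w i)) / 2).
  rewrite (mean_sym _ negK); apply: eq_mean => w.
  congr ((_ + fmax _) / 2); apply/funext => i; by rewrite gneg.
rewrite -meanZ.
apply: le_trans (_ : mean (fun w => psi a + psi b + `|g w a - g w b|) <= _).
  rewrite meanD (mean_cst w0); have := phig a b.
  by have := ler_norm (phi a - phi b); lra.
apply: ler_mean => w; rewrite mulrC divfK//.
have h1 i := le_fmax (fun i => psi i + g w i) i.
have h2 i := le_fmax (fun i => psi i - g w i) i.
(* The sign of [g w a - g w b] decides which of [a] and [b] is tested in the maximum with [g] and
   which in the one with [- g]. *)
rewrite /Mx; have [_|_] := ger0P (g w a - g w b).
  by have := h1 a; have := h2 b; lra.
by have := h1 b; have := h2 a; lra.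
Qed.

End FiniteMax.

(** * Inner products, Euclidean norms and quadratic forms *)

Section Forms.
Context {R : realType}.

Definition dotr k (v w : 'rV[R]_k) : R := \sum_j v ord0 j * w ord0 j.

Definition qform k (A : 'M[R]_k) (v : 'rV[R]_k) : R :=
  (v *m A *m v^T) ord0 ord0.

Lemma dotrC k (v w : 'rV[R]_k) : dotr v w = dotr w v.
Proof. by apply: eq_bigr => j _; rewrite mulrC. Qed.

Lemma dotrDl k (u v w : 'rV[R]_k) : dotr (u + v) w = dotr u w + dotr v w.
Proof. by rewrite -big_split; apply: eq_bigr => j _; rewrite mxE mulrDl. Qed.

Lemma dotrZl k c (v w : 'rV[R]_k) : dotr (c *: v) w = c * dotr v w.
Proof. by rewrite mulr_sumr; apply: eq_bigr => j _; rewrite mxE mulrA. Qed.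

Lemma dotrDr k (u v w : 'rV[R]_k) : dotr w (u + v) = dotr w u + dotr w v.
Proof. by rewrite dotrC dotrDl !(dotrC w). Qed.

Lemma dotrZr k c (v w : 'rV[R]_k) : dotr v (c *: w) = c * dotr v w.
Proof. by rewrite dotrC dotrZl dotrC. Qed.

Lemma dotrNl k (v w : 'rV[R]_k) : dotr (- v) w = - dotr v w.
Proof. by rewrite -scaleN1r dotrZl mulN1r. Qed.

Lemma dotrBr k (u v w : 'rV[R]_k) : dotr w (u - v) = dotr w u - dotr w v.
Proof. by rewrite dotrDr (dotrC w (- v)) dotrNl (dotrC v). Qed.

Lemma dotrE k (v w : 'rV[R]_k) : dotr v w = (v *m w^T) ord0 ord0.
Proof. by rewrite mxE; apply: eq_bigr => j _; rewrite mxE. Qed.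

Lemma dotrr_ge0 k (v : 'rV[R]_k) : 0 <= dotr v v.
Proof. by apply: sumr_ge0 => j _; rewrite -expr2 sqr_ge0. Qed.

Lemma enormE k (v : 'rV[R]_k) : enorm v = Num.sqrt (dotr v v).
Proof. by congr Num.sqrt; apply: eq_bigr => j _; rewrite expr2. Qed.

Lemma sqr_enorm k (v : 'rV[R]_k) : enorm v ^+ 2 = dotr v v.
Proof. by rewrite enormE sqr_sqrtr ?dotrr_ge0. Qed.

Lemma enorm_ge0 k (v : 'rV[R]_k) : 0 <= enorm v.
Proof. by rewrite enormE sqrtr_ge0. Qed.

Lemma cauchy_schwarz k (v w : 'rV[R]_k) : dotr v w ^+ 2 <= dotr v v * dotr w w.
Proof.
have [w0|w0] := eqVneq (dotr w w) 0.
  have w0' j : w ord0 j = 0.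
    move/eqP: w0; rewrite psumr_eq0 => [/allP/(_ j)|i _]; last first.
      by rewrite -expr2 sqr_ge0.
    by rewrite mem_index_enum => /(_ isT); rewrite mulf_eq0 orbb => /eqP.
  rewrite w0 mulr0 /dotr big1 ?expr0n// => j _; by rewrite w0' mulr0.
have {}w0 : 0 < dotr w w by rewrite lt_def w0 dotrr_ge0.
(* The squared norm of this vector is [c * (a * c - b ^+ 2)] in the notation set below, and [c] is
   positive. *)
have := dotrr_ge0 (dotr w w *: v - dotr v w *: w).
rewrite dotrBr !(dotrC (_ - _)) !dotrBr !dotrZr !dotrZl (dotrC w v).
set a := dotr v v; set b := dotr v w; set c := dotr w w => h.
have {}h : 0 <= c * (a * c - b ^+ 2) by apply: le_trans h _; lra.
by rewrite pmulr_rge0// subr_ge0 in h.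
Qed.

Lemma dotr_le_enorm k (v w : 'rV[R]_k) : `|dotr v w| <= enorm v * enorm w.
Proof.
by rewrite !enormE -sqrtrM ?dotrr_ge0// -sqrtr_sqr ler_wsqrtr// cauchy_schwarz.
Qed.

Lemma enorm_tri k (v w : 'rV[R]_k) : enorm (v + w) <= enorm v + enorm w.
Proof.
rewrite -(@ler_pXn2r _ 2)// ?nnegrE ?addr_ge0 ?enorm_ge0//.
rewrite sqrrD !sqr_enorm dotrDl !dotrDr (dotrC w v).
by have := dotr_le_enorm v w; have := ler_norm (dotr v w); lra.
Qed.

Lemma enormZ k c (v : 'rV[R]_k) : enorm (c *: v) = `|c| * enorm v.
Proof.
by rewrite !enormE dotrZl dotrZr mulrA -expr2 sqrtrM ?sqr_ge0// sqrtr_sqr.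
Qed.

Lemma qformE k (A : 'M[R]_k) v : qform A v = \sum_i \sum_j v ord0 i * A i j * v ord0 j.
Proof.
rewrite /qform mxE exchange_big /=; apply: eq_bigr => j _.
by rewrite !mxE mulr_suml; apply: eq_bigr => i _.
Qed.

Lemma qformD k (A B : 'M[R]_k) v : qform (A + B) v = qform A v + qform B v.
Proof. by rewrite /qform mulmxDr mulmxDl mxE. Qed.

Lemma qformZ k c (A : 'M[R]_k) v : qform (c *: A) v = c * qform A v.
Proof. by rewrite /qform -scalemxAr -scalemxAl mxE. Qed.

Lemma qformB k (A B : 'M[R]_k) v : qform (A - B) v = qform A v - qform B v.
Proof. by rewrite qformD -scaleN1r qformZ mulN1r. Qed.

Lemma qform_gram p k (F : 'M[R]_(p, k)) v :
  qform (F^T *m F) v = dotr (v *m F^T) (v *m F^T).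
Proof. by rewrite dotrE trmx_mul trmxK /qform !mulmxA. Qed.

Lemma psdD k (A B : 'M[R]_k) : psd A -> psd B -> psd (A + B).
Proof.
move=> [As A0] [Bs B0]; split=> [|v]; first by rewrite linearD /= As Bs.
by rewrite -/(qform _ _) qformD addr_ge0 ?A0 ?B0.
Qed.

Lemma psdZ k c (A : 'M[R]_k) : 0 <= c -> psd A -> psd (c *: A).
Proof.
move=> c0 [As A0]; split=> [|v]; first by rewrite linearZ /= As.
by rewrite -/(qform _ _) qformZ mulr_ge0 ?A0.
Qed.

End Forms.

(** * Schur complements and Cholesky factorization *)

Section Factorization.
Context {R : realType}.

Lemma qform_block k (a : 'M[R]_1) (r : 'rV[R]_k) (D : 'M[R]_k) (x : 'M[R]_1) v :
  qform (block_mx a r r^T D) (row_mx x v) =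
  a ord0 ord0 * x ord0 ord0 ^+ 2 + 2 * x ord0 ord0 * dotr r v + qform D v.
Proof.
rewrite /qform mul_row_block tr_row_mx mul_row_col !mulmxDl mxE.
have addE (M N : 'M[R]_1) : (M + N) ord0 ord0 = M ord0 ord0 + N ord0 ord0.
  by rewrite mxE.
rewrite !addE addrA dotrE.
set X := x ord0 ord0.
have xE : x = X%:M by rewrite [LHS]mx11_scalar.
have aE : a = (a ord0 ord0)%:M by rewrite [LHS]mx11_scalar.
rewrite xE aE !tr_scalar_mx !mul_mx_scalar !mul_scalar_mx.
have -> : v *m r^T = (r *m v^T)^T by rewrite trmx_mul trmxK.
rewrite -!scalemxAl !mxE !eqxx !mulr1n; ring.
Qed.

(** The form at [row_mx x v] is a quadratic polynomial in [x]. For [a != 0] its minimum over [x] is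
    the Schur complement at [v]. For [a = 0] it is affine in [x], which forces [r = 0], and the
    complement is [D] because [0^-1 = 0]. *)
Lemma psd_schur k (a : R) (r : 'rV[R]_k) (D : 'M[R]_k) :
  psd (block_mx a%:M r r^T D) ->
  [/\ 0 <= a, a = 0 -> r = 0 & psd (D - a^-1 *: (r^T *m r))].
Proof.
move=> [sym pos].
have posE (x : R) v : 0 <= a * x ^+ 2 + 2 * x * dotr r v + qform D v.
  by have := pos (row_mx x%:M v); rewrite -/(qform _ _) qform_block !mxE !eqxx !mulr1n.
have q0 : qform D 0 = 0 by rewrite /qform mul0mx mul0mx mxE.
have d0 : dotr r 0 = 0 by rewrite dotrE linear0 mulmx0 mxE.
have a0 : 0 <= a by have := posE 1 0; rewrite q0 d0; lra.
have r0 : a = 0 -> r = 0.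
  move=> aE; pose c := dotr r r; pose q := qform D r.
  have h t : 0 <= 2 * t * c + q by have := posE t r; rewrite aE mul0r add0r.
  have c0 : c = 0.
    apply/eqP; apply: contraT => cn0.
    (* The affine function of [t] is evaluated where it takes the value [- 1]. *)
    have : 0 <= 2 * (- (q + 1) / (2 * c)) * c + q by exact: h.
    have -> : 2 * (- (q + 1) / (2 * c)) * c + q = - 1 by field.
    by lra.
  apply/rowP => j; rewrite mxE; move/eqP: c0; rewrite /c psumr_eq0.
    move=> /allP/(_ j); rewrite mem_index_enum => /(_ isT).
    by rewrite mulf_eq0 orbb => /eqP.
  by move=> i _; rewrite -expr2 sqr_ge0.
split=> //; split.
  move: sym; rewrite tr_block_mx => /eq_block_mx [_ _ _ Ds].
  by rewrite linearB /= linearZ /= trmx_mul trmxK Ds.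
move=> v; rewrite -/(qform _ _) qformB qformZ qform_gram.
have -> : dotr (v *m r^T) (v *m r^T) = dotr r v ^+ 2.
  by rewrite /dotr big_ord1 -/(dotr r v) -dotrE dotrC expr2.
have [aE|an0] := eqVneq a 0.
  by have := posE 0 v; rewrite aE invr0; lra.
have := posE (- a^-1 * dotr r v) v.
suff -> : a * (- a^-1 * dotr r v) ^+ 2 + 2 * (- a^-1 * dotr r v) * dotr r v =
   - (a^-1 * dotr r v ^+ 2) by rewrite addrC.
by field.
Qed.

(** Cholesky: peel off the first row and column, and factor the Schur complement by induction. The
    block upper triangular factor has first row [(sqrt a, r / sqrt a)]. *)
Lemma psd_factor k (A : 'M[R]_k) : psd A -> exists F : 'M[R]_k, A = F^T *m F.
Proof.
elim: k A => [A _|k IH]; first by exists 0; apply/matrixP => - [].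
rewrite -[k.+1]/(1 + k)%N => A psdA.
have [As _] := psdA.
have AE : A = block_mx (A ord0 ord0)%:M (ursubmx A) (ursubmx A)^T (drsubmx A).
  rewrite -{1}[A]submxK; congr block_mx; last by rewrite trmx_ursub As.
  by rewrite [LHS]mx11_scalar !mxE; congr (A _ _)%:M; apply: val_inj.
rewrite AE in psdA; have [a0 r0 /IH [F FE]] := psd_schur psdA.
set a := A ord0 ord0 in a0 r0 FE *; set r := ursubmx A in r0 FE *.
exists (block_mx (Num.sqrt a)%:M ((Num.sqrt a)^-1 *: r) 0 F).
rewrite AE tr_block_mx mulmx_block -FE !trmx0 !mul0mx !mulmx0 !addr0.
(* A zero pivot is harmless: then [r = 0] and both sides vanish. *)
have rE : ((Num.sqrt a)^-1 * Num.sqrt a) *: r = r.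
  have [aE|an0] := eqVneq a 0; first by rewrite r0// scaler0.
  by rewrite mulVf ?scale1r// sqrtr_eq0 -ltNge lt_def an0.
have tZ c : (c *: r)^T = c *: r^T by rewrite linearZ.
rewrite tr_scalar_mx tZ -/r; congr block_mx.
- by rewrite -scalar_mxM -expr2 sqr_sqrtr.
- by rewrite mul_scalar_mx scalerA mulrC rE.
- by rewrite mul_mx_scalar scalerA mulrC -tZ rE.
- rewrite -scalemxAl -scalemxAr scalerA -invfM -expr2 sqr_sqrtr//.
  by rewrite addrC subrK.
Qed.

End Factorization.

(** * Vector contraction to a linear process *)

Section Contraction.
Context {R : realType}.

(** Induction on the list [s] of signs not yet replaced; [x] accumulates the vectors that replaced
    the others, so it has to stay general. Once no sign is left, Cauchy-Schwarz bounds the linear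
    process by [rho] times the norm of [x]. *)
Lemma rademacher_linear_step (I : finType) (i0 : I) n m (rho : R)
    (w : I -> 'rV[R]_m) (phi : 'I_n -> I -> R) (J : finType) (w0 : J)
    (neg : J -> J) (xi : 'I_n -> J -> 'rV[R]_m) (s : seq 'I_n) x :
  0 <= rho -> (forall i, enorm (w i) <= rho) ->
  involutive neg -> (forall j o, xi j (neg o) = - xi j o) ->
  (forall j i i', `|phi j i - phi j i'| <=
     mean (fun o => `|dotr (xi j o) (w i) - dotr (xi j o) (w i')|)) ->
  uniq s ->
  mean (fun e : {ffun 'I_n -> bool} =>
    fmax i0 (fun i => dotr x (w i) + \sum_(j <- s) sgnb e j * phi j i))
  <= rho * Num.sqrt (dotr x x + \sum_(j <- s) mean (fun o => dotr (xi j o) (xi j o))).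
Proof.
move=> rho0 wrho negK xineg phixi; elim: s x => [|j s IH] x.
  move=> _; rewrite big_nil addr0 -enormE.
  rewrite -[leRHS](mean_cst [ffun _ : 'I_n => true]); apply: ler_mean => e.
  apply: fmax_le => i; rewrite big_nil addr0 mulrC.
  apply: le_trans (ler_norm _) _; apply: le_trans (dotr_le_enorm _ _) _.
  by rewrite ler_wpM2l ?enorm_ge0.
move=> /= /andP[js us].
set S := \sum_(j' <- s) mean (fun o => dotr (xi j' o) (xi j' o)).
pose psi e i := dotr x (w i) + \sum_(j' <- s) sgnb e j' * phi j' i.
(* Pairing [e] with [flip j e] freezes the other signs, and the contraction trades the sign of index
   [j] for the random vector [xi j o]. *)
apply: (@le_trans _ _ (mean (fun o => mean (fun e : {ffun 'I_n -> bool} =>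
    fmax i0 (fun i => dotr (x + xi j o) (w i) +
                      \sum_(j' <- s) sgnb e j' * phi j' i))))).
  rewrite mean_exchange (mean_sym _ (flipK j)); apply: ler_mean => e.
  rewrite ler_pdivrMr// [leRHS]mulrC.
  have Ee (e' : {ffun 'I_n -> bool}) : (forall i, \sum_(j' <- s) sgnb e' j' * phi j' i =
        \sum_(j' <- s) sgnb e j' * phi j' i) ->
      fmax i0 (fun i => dotr x (w i) + \sum_(j' <- j :: s) sgnb e' j' * phi j' i) =
      fmax i0 (fun i => psi e i + sgnb e' j * phi j i).
    move=> ee; congr fmax; apply/funext => i.
    by rewrite big_cons ee /psi addrA addrAC.
  rewrite !Ee//; last by move=> i; exact: sum_sgnb_flip.
  rewrite sgnb_flip_eq.
  apply: le_trans (_ : 2 * mean (fun o => fmax i0 (fun i => psi e i + dotr (xi j o)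
    (w i))) <= _).
    have -> : (fun i => psi e i + - sgnb e j * phi j i) =
              (fun i => psi e i - sgnb e j * phi j i).
      by apply/funext => i; rewrite mulNr.
    apply: (@fmax_contraction _ _ i0 _ w0 neg (fun o i => dotr (xi j o) (w i))
      (psi e) (fun i => sgnb e j * phi j i)) => //.
      by move=> o i; rewrite xineg dotrNl.
    move=> i i'; rewrite -mulrBr normrM.
    have -> : `|sgnb e j : R| = 1 by rewrite /sgnb normr_sign.
    by rewrite mul1r.
  rewrite ler_wpM2l// ; apply: ler_mean => o.
  apply: fmax_le => i; apply: le_trans (le_fmax i0 _ i).
  by rewrite /psi dotrDl; lra.
apply: (@le_trans _ _ (mean (fun o =>
    rho * Num.sqrt (dotr (x + xi j o) (x + xi j o) + S)))).
  by apply: ler_mean => o; exact: IH.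
have S0 : 0 <= S.
  by apply: sumr_ge0 => j' _; rewrite mulr_ge0 ?invr_ge0// sumr_ge0// => o _;
    exact: dotrr_ge0.
(* Concavity of the square root moves the mean over [o] inside. *)
rewrite meanZ ler_wpM2l//; apply: le_trans (mean_sqrt_le w0 _) _.
  by move=> o; rewrite addr_ge0 ?dotrr_ge0.
(* Pairing [o] with [neg o] cancels the cross terms between [x] and [xi j o], so squared norms
   simply add up. *)
rewrite ler_wsqrtr// big_cons (mean_sym _ negK).
rewrite (@eq_mean _ _ _ (fun o => dotr x x + S + dotr (xi j o) (xi j o))).
  by rewrite meanD (mean_cst w0) -/S; lra.
move=> o; rewrite xineg !dotrDl !dotrDr !dotrNl !(dotrC _ (- _)) !dotrNl
  (dotrC (xi j o) x).
by field.
Qed.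

(** Khintchine's inequality for the coordinates of [v *m F^T]; its constant 2 is absorbed into the
    random vector. *)
Lemma enorm_gram_mean m (F : 'M[R]_m) (v : 'rV[R]_m) :
  enorm (v *m F^T) <= mean (fun e : {ffun 'I_m -> bool} =>
     `|dotr (2 *: ((\row_k sgnb e k) *m F)) v|).
Proof.
have E e : dotr (2 *: ((\row_k sgnb e k) *m F)) v =
    2 * \sum_k sgnb e k * (v *m F^T) ord0 k.
  rewrite dotrZl dotrE -mulmxA; congr (_ * _).
  rewrite -[F *m v^T]trmxK trmx_mul trmxK -dotrE.
  by apply: eq_bigr => k _; rewrite mxE.
rewrite /enorm; apply: le_trans (khintchine _) _.
rewrite -meanZ; apply: ler_mean => e.
by rewrite E normrM (@ger0_norm _ 2).
Qed.

(** Each coordinate is a signed sum over a column of [F], so orthogonality of the signs leaves the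
    sum of all squared entries; 4 is the square of Khintchine's constant. *)
Lemma mean_dotr_sign_gram m (F : 'M[R]_m) :
  mean (fun e : {ffun 'I_m -> bool} =>
     dotr (2 *: ((\row_k sgnb e k) *m F)) (2 *: ((\row_k sgnb e k) *m F)))
  = 4 * \tr (F^T *m F).
Proof.
rewrite (@eq_mean _ _ _ (fun e : {ffun 'I_m -> bool} =>
   4 * \sum_j (\sum_k sgnb e k * F k j) ^+ 2)); last first.
  move=> e; rewrite dotrZl dotrZr mulrA; congr (_ * _); first by ring.
  apply: eq_bigr => j _; rewrite expr2 !mxE.
  by congr (_ * _); apply: eq_bigr => k _; rewrite mxE.
rewrite meanZ mean_sum; congr (_ * _).
rewrite /mxtrace; apply: eq_bigr => j _; rewrite mean_sqr_sum_sgnb mxE.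
by apply: eq_bigr => k _; rewrite mxE expr2.
Qed.

(** Selecting one point [w e] per sign pattern stands in for the supremum over the ball and keeps
    the index set of the maximum finite. The factor 2 is the square root of the 4 in
    [mean_dotr_sign_gram]. *)
Lemma rademacher_selection n m (rho : R) (phi : 'I_n -> 'rV[R]_m -> R)
    (A : 'I_n -> 'M[R]_m) (w : {ffun 'I_n -> bool} -> 'rV[R]_m) :
  0 <= rho -> (forall i, psd (A i)) -> (forall e, eball rho (w e)) ->
  (forall i v v', eball rho v -> eball rho v' ->
     (phi i v - phi i v') ^+ 2 <= qform (A i) (v - v')) ->
  mean (fun e => \sum_i sgnb e i * phi i (w e))
    <= 2 * rho * Num.sqrt (\sum_i \tr (A i)).
Proof.
move=> rho0 psdA wrho lip.
have /choice [F FE] i := psd_factor (psdA i).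
pose xi i e := 2 *: ((\row_k sgnb e k) *m F i).
have lipF j e e' : `|phi j (w e) - phi j (w e')| <=
    mean (fun o => `|dotr (xi j o) (w e) - dotr (xi j o) (w e')|).
  under eq_mean do rewrite -dotrBr.
  apply: le_trans (enorm_gram_mean (F j) _).
  rewrite enormE -qform_gram -FE -sqrtr_sqr ler_wsqrtr//.
  exact: lip.
have := @rademacher_linear_step _
  [ffun _ : 'I_n => true] n m rho w (fun j e => phi j (w e)) _
  [ffun _ : 'I_m => true] (@flip_all m) xi (index_enum 'I_n) 0 rho0 wrho (@flip_allK m).
move=> /(_ _ lipF (index_enum_uniq _)) H.
apply: le_trans (_ : _ <= rho * Num.sqrt (dotr (0 : 'rV[R]_m) 0 + \sum_j mean (fun
  o => dotr (xi j o) (xi j o)))) _.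
  apply: le_trans (H _); last first.
    move=> j o; rewrite /xi -scalerN -mulNmx; congr (_ *: (_ *m _)).
    by apply/rowP => k; rewrite !mxE sgnb_flip_all.
  (* The value at the selected [w e] is at most the maximum over the points selected for all
     patterns; the linear part starts from [x = 0]. *)
  apply: ler_mean => e; apply: le_trans (le_fmax _ _ e).
  by rewrite dotrE mul0mx mxE add0r.
rewrite dotrE mul0mx mxE add0r (mulrC 2) -[leRHS]mulrA ler_wpM2l//.
rewrite (eq_bigr (fun j => 4 * \tr (A j))).
  rewrite -mulr_sumr sqrtrM// (_ : 4 = 2 ^+ 2); last by ring.
  by rewrite sqrtr_sqr ger0_norm// mulrC.
by move=> j _; rewrite /xi mean_dotr_sign_gram FE.
Qed.

End Contraction.

(** * Second-order calculus *)

Section Differentials.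
Context {R : realType}.

Lemma is_derive_line (V W : normedModType R) (f : V -> W) (w v : V) (s : R) :
  differentiable f (w + s *: v) ->
  is_derive s 1 (fun x : R => f (w + x *: v)) ('d f (w + s *: v) v).
Proof.
move=> df; pose line (x : R) := w + x *: v.
have dl : is_diff s line (fun h : R => h *: v).
  apply: (is_diff_eq (is_diffD (is_diff_cst w s) (is_diff_scalel s v))).
  by apply/funext => h /=; rewrite add0r.
have dfl : differentiable (f \o line) s.
  by apply: differentiable_comp => //; exact: ex_diff.
apply: DeriveDef.
  exact: diff_derivable.
rewrite deriveE// (@diff_comp _ _ _ _ line f)//=.
by rewrite diff_val scale1r.
Qed.

Lemma row_continuous m n (k : 'I_m) : continuous (row k : 'M[R]_(m, n) -> 'rV[R]_n).
Proof.
move=> u A /nbhs_ballP[e /= e0 eA].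
apply/nbhs_ballP; exists e => //= v [_ uv]; apply: eA; split => // i j.
by apply: (le_lt_trans _ (uv k j)); rewrite !mxE.
Qed.

Lemma differentiable_entry (V : normedModType R) p q (F : V -> 'M[R]_(p, q)) w a b :
  differentiable F w -> differentiable (fun x => F x a b) w.
Proof.
move=> dF; apply: (@differentiable_comp _ _ _ _ F (fun N : 'M[R]_(p, q) => N a b))
  => //.
exact: differentiable_coord.
Qed.

Lemma diff_entry (V : normedModType R) p q (F : V -> 'M[R]_(p, q)) w a b v :
  differentiable F w -> 'd (fun x => F x a b) w v = 'd F w v a b.
Proof.
move=> dF; rewrite -!deriveE//; last exact: differentiable_entry.
by rewrite derive_mx ?mxE//; exact: diff_derivable.
Qed.

Lemma differentiable_row (V : normedModType R) p q (F : V -> 'M[R]_(p, q)) w k :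
  differentiable F w -> differentiable (fun x => row k (F x)) w.
Proof.
move=> dF; apply: (@differentiable_comp _ _ _ _ F (row k)) => //.
apply: linear_differentiable; exact: row_continuous.
Qed.

Lemma diff_jac m C (f : 'rV[R]_m -> 'rV[R]_C) w v :
  'd f w v = v *m (jac f w)^T.
Proof. by rewrite /jac trmxK /jacobian mul_rV_lin1. Qed.

Lemma jacE m C (f : 'rV[R]_m -> 'rV[R]_C) w k a :
  jac f w k a = 'd f w (delta_mx ord0 a) ord0 k.
Proof. by rewrite diff_jac -rowE !mxE. Qed.

Lemma diff_grad k (g : 'rV[R]_k -> R) z v : 'd g z v = dotr (grad g z) v.
Proof.
rewrite {1}(row_sum_delta v) linear_sum; apply: eq_bigr => j _.
by rewrite linearZ /= mxE mulrC.
Qed.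

Lemma grad_entry m C (f : 'rV[R]_m -> 'rV[R]_C) w k : differentiable f w ->
  grad (fun x => f x ord0 k) w = row k (jac f w).
Proof. by move=> df; apply/rowP => a; rewrite !mxE diff_entry// -jacE !mxE. Qed.

Lemma diff_comp_jac m C (g : 'rV[R]_C -> R) (f : 'rV[R]_m -> 'rV[R]_C) w v :
  differentiable f w -> differentiable g (f w) ->
  dotr (grad (g \o f) w) v = dotr (grad g (f w)) (v *m (jac f w)^T).
Proof. by move=> df dg; rewrite -!diff_grad diff_comp//= diff_jac. Qed.

(** Links the two encodings of second derivatives: [hess] differentiates the gradient of one
    component, whereas [class_C2] speaks of the differential of the whole Jacobian. The last index
    is the direction of the second differentiation. *)
Lemma hessE m C (f : 'rV[R]_m -> 'rV[R]_C) k w a b : class_C2 f ->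
  hess (fun x => f x ord0 k) w a b = 'd (jac f) w (delta_mx ord0 b) k a.
Proof.
move=> [df dJ _]; rewrite /hess jacE.
have -> : grad (fun x => f x ord0 k) = (fun x => row k (jac f x)).
  by apply/funext => x; rewrite grad_entry.
rewrite -diff_entry; last exact: differentiable_row.
have -> : (fun x => row k (jac f x) ord0 a) = (fun x => jac f x k a).
  by apply/funext => x; rewrite mxE.
exact: diff_entry.
Qed.

End Differentials.

(** * Symmetry of second derivatives *)

Section SymmetricHessian.
Context {R : realType} {V : normedModType R}.

Lemma MVT_line (g : V -> R) (w v : V) (t : R) : 0 < t ->
  (forall x, differentiable g x) ->
  exists2 c, 0 <= c <= t & g (w + t *: v) - g w = t * 'd g (w + c *: v) v.
Proof.
move=> t0 dg; have [||c ct] := @MVT R (fun x => g (w + x *: v))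
    (fun x => 'd g (w + x *: v) v) 0 t t0.
- by move=> x _; exact: is_derive_line.
- apply: derivable_within_continuous => x _.
  exact: (@ex_derive _ _ _ _ _ _ _ (is_derive_line (dg _))).
rewrite scale0r addr0 subr0 mulrC => gE; exists c => //.
by move: ct; rewrite in_itv /= => /andP[/ltW -> /ltW ->].
Qed.

(** Two mean value theorems: along [a] for the increment [g2] of [g] by [t *: b], then along [b] for
    the derivative of [g] in direction [a]. *)
Lemma MVT_square (g : V -> R) (w a b : V) (t : R) : 0 < t ->
  (forall x, differentiable g x) ->
  (forall x, differentiable (fun y => 'd g y a) x) ->
  exists c d, [/\ 0 <= c <= t, 0 <= d <= t &
    g (w + t *: a + t *: b) - g (w + t *: b) - (g (w + t *: a) - g w) =
    t ^+ 2 * 'd (fun y => 'd g y a) (w + c *: a + d *: b) b].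
Proof.
move=> t0 dg dga; pose g2 x := g (x + t *: b) - g x.
have ds x : is_diff x (fun y => y + t *: b) id.
  apply: (is_diff_eq (is_diffD (is_diff_id x) (is_diff_cst (t *: b) x))).
  by apply/funext => h /=; rewrite addr0.
have dgs x : differentiable (fun y => g (y + t *: b)) x.
  by apply: (@differentiable_comp _ _ _ _ (fun y => y + t *: b) g) => //;
    exact: ex_diff.
have dg2 x : differentiable g2 x by apply: differentiableB.
have dg2E x v : 'd g2 x v = 'd g (x + t *: b) v - 'd g x v.
  rewrite (@diffB _ _ _ (fun y => g (y + t *: b)) g)//=; congr (_ - _).
  rewrite (@diff_comp _ _ _ _ (fun y => y + t *: b) g)//=.
  by rewrite diff_val.
have [c ct cE] := MVT_line w a t0 dg2.
have [d' dt dE] := MVT_line (w + c *: a) b t0 dga.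
exists c, d'; split=> //; rewrite expr2 -mulrA -dE -dg2E -cE /g2.
by rewrite opprB; ring.
Qed.

(** Schwarz's theorem. The second difference over a small parallelogram is symmetric in [a] and [b],
    so both mixed derivatives take a common value at points near [w]; continuity at [w]
    concludes. *)
Lemma diff_diffC (g : V -> R) (w a b : V) :
  (forall x, differentiable g x) ->
  (forall x, differentiable (fun y => 'd g y a) x) ->
  (forall x, differentiable (fun y => 'd g y b) x) ->
  {for w, continuous (fun y => 'd (fun z => 'd g z a) y b)} ->
  {for w, continuous (fun y => 'd (fun z => 'd g z b) y a)} ->
  'd (fun y => 'd g y a) w b = 'd (fun y => 'd g y b) w a.
Proof.
move=> dg dga dgb cab cba; apply/eqP; rewrite -subr_eq0 -normr_le0.
apply/ler_addgt0Pl => e e0; rewrite addr0.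
have e20 : 0 < e / 2 by rewrite divr_gt0.
have /cvgrPdist_lt/(_ _ e20)/nbhs_ballP [d1 /= d10 h1] := cab.
have /cvgrPdist_lt/(_ _ e20)/nbhs_ballP [d2 /= d20 h2] := cba.
pose r := Num.min d1 d2; have r0 : 0 < r by rewrite lt_min d10 d20.
pose N := `|a| + `|b| + 1.
have N0 : 0 < N by rewrite ltr_wpDl// addr_ge0.
(* The side is small enough to keep the whole parallelogram within [r] of [w]; the 1 in [N] covers
   [a = b = 0]. *)
pose t := r / N; have t0 : 0 < t by rewrite divr_gt0.
have small c d x y : 0 <= c <= t -> 0 <= d <= t -> `|x| + `|y| + 1 = N ->
    `|w - (w + c *: x + d *: y)| < r.
  move=> /andP[c0 ct] /andP[d0 dt] xy.
  rewrite -addrA opprD addNKr normrN (le_lt_trans (ler_normD _ _))// !normrZ.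
  rewrite !ger0_norm//; apply: (@le_lt_trans _ _ (t * (`|x| + `|y|))).
    by rewrite mulrDr lerD// ler_wpM2r.
  rewrite -[ltRHS](divfK (lt0r_neq0 N0)) -/t ltr_pM2l// -xy.
  by rewrite ltrDl.
have [c [d [ct dt E1]]] := MVT_square w b t0 dg dga.
have [c' [d' [ct' dt' E2]]] := MVT_square w a t0 dg dgb.
have E : 'd (fun y => 'd g y a) (w + c *: a + d *: b) b =
         'd (fun y => 'd g y b) (w + c' *: b + d' *: a) a.
  have t20 : t ^+ 2 != 0 by rewrite expf_neq0// lt0r_neq0.
  apply: (mulfI t20); rewrite -E1 -E2 (addrAC w (t *: b)); ring.
have := h1 (w + c *: a + d *: b); rewrite -ball_normE /= => /(_ _)/wrap[].
  by apply: lt_le_trans (small _ _ _ _ ct dt erefl) _; rewrite ge_min lexx.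
have := h2 (w + c' *: b + d' *: a); rewrite -ball_normE /= => /(_ _)/wrap[].
  apply: lt_le_trans (small _ _ _ _ ct' dt' _) _; last by rewrite ge_min lexx orbT.
  by rewrite [`|b| + _]addrC.
rewrite -E; set x := 'd _ _ _; set y := 'd _ _ _; set z := 'd _ _ _.
move=> h3 h4; apply/ltW; rewrite (_ : z - x = (z - y) - (x - y)); last by ring.
apply: le_lt_trans (ler_normB _ _) _.
by move: h3 h4; rewrite -/x -/y -/z; lra.
Qed.

End SymmetricHessian.

(** * Squared increments of curves *)

Section CurveBounds.
Context {R : realType}.
Local Notation mu := (@lebesgue_measure R).

Lemma continuous_sum_fun (T : topologicalType) n (F : 'I_n -> T -> R) :
  (forall i, continuous (F i)) -> continuous (fun x => \sum_i F i x).
Proof.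
move=> cF x; apply: cvg_big => //; last by move=> i _; exact: cF.
by move=> y; exact: add_continuous.
Qed.

Lemma continuous_dotr (T : topologicalType) n (F G : T -> 'rV[R]_n) :
  (forall i, continuous (fun x => F x ord0 i)) ->
  (forall i, continuous (fun x => G x ord0 i)) ->
  continuous (fun x => dotr (F x) (G x)).
Proof.
move=> cF cG; apply: continuous_sum_fun => i x.
by apply: cvgM; [exact: cF|exact: cG].
Qed.

(** The tangent at [a] lies below the squared norm. Being affine in [b], it can be integrated along
    a curve by the fundamental theorem of calculus. *)
Lemma dotr_polar n (a b : 'rV[R]_n) : 2 * dotr a b - dotr a a <= dotr b b.
Proof.
have := dotrr_ge0 (a - b).
by rewrite !dotrBr !(dotrC (_ - _)) !dotrBr (dotrC b a); lra.
Qed.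

Lemma increment_le_integral n (g dg : R -> 'rV[R]_n) :
  (forall i (s : R), is_derive s 1 (fun x => g x ord0 i) (dg s ord0 i)) ->
  (forall i, continuous (fun s => dg s ord0 i)) ->
  ((dotr (g 1 - g 0) (g 1 - g 0))%:E <=
   \int[mu]_(s in `[0%R, 1%R]) (dotr (dg s) (dg s))%:E)%E.
Proof.
move=> gd cdg; set a := g 1 - g 0; set A := dotr a a.
(* The integrand [2 <a, g'> - |a|^2] is at most [|g'|^2] and integrates to
   [|a|^2]. *)
pose G (s : R) := 2 * dotr a (g s) - A * s.
pose dG (s : R) := 2 * dotr a (dg s) - A.
have Gd (s : R) : is_derive s 1 G (dG s).
  have d1 : is_derive s 1 (fun x => dotr a (g x)) (dotr a (dg s)).
    rewrite /dotr.
    have -> : (fun x => \sum_j a ord0 j * g x ord0 j) =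
              \sum_j (fun x => a ord0 j * g x ord0 j).
      by apply/funext => x; rewrite fct_sumE.
    exact: is_derive_sum.
  have d2 : is_derive s 1 (fun x => 2 * dotr a (g x)) (2 * dotr a (dg s)).
    exact: (@is_deriveZ _ _ _ (fun x => dotr a (g x)) 2 s 1 _ d1).
  have d3 : is_derive s 1 (fun x : R => A * x) A.
    rewrite -[X in is_derive _ _ _ X](mulr1 A).
    exact: (@is_deriveZ _ _ _ id A s 1 1 (is_derive_id s 1)).
  exact: (@is_deriveB _ _ _ (fun x => 2 * dotr a (g x)) (fun x => A * x) s 1 _ _ d2 d3).
have cq : continuous (fun s => dotr (dg s) (dg s)) by exact: continuous_dotr.
have cdG : continuous dG.
  have cd : continuous (fun s => dotr a (dg s)).
    by apply: continuous_dotr => // i x; exact: cvg_cst.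
  move=> x; apply: cvgB; last exact: cvg_cst.
  by apply: cvgM; [exact: cvg_cst|exact: cd].
have cG : continuous G.
  move=> x; apply: differentiable_continuous; apply/derivable1_diffP.
  exact: (@ex_derive _ _ _ _ _ _ _ (Gd x)).
have -> : A%:E = (\int[mu]_(s in `[0%R, 1%R]) (dG s)%:E)%E.
  rewrite (@continuous_FTC2 _ dG G 0 1)//.
  - rewrite -EFinB /G mulr0 subr0 mulr1 /A; congr _%:E.
    by rewrite {3 5}/a !dotrBr; ring.
  - exact: continuous_subspaceT.
  - split.
    + by move=> x _; exact: (@ex_derive _ _ _ _ _ _ _ (Gd x)).
    + by apply: cvg_at_right_filter; exact: cG.
    + by apply: cvg_at_left_filter; exact: cG.
  - by move=> x _; rewrite derive1E (@derive_val _ _ _ _ _ _ _ (Gd x)).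
apply: le_integral; first exact: measurable_itv.
- exact: (continuous_compact_integrable (@segment_compact _ 0 1)
  (continuous_subspaceT cdG)).
- exact: (continuous_compact_integrable (@segment_compact _ 0 1)
  (continuous_subspaceT cq)).
- move=> s _; rewrite lee_fin /dG.
  exact: dotr_polar.
Qed.

End CurveBounds.

(** * Quadratic forms of Gram and rank-one matrices *)

Section RankOneForms.
Context {R : realType}.

Lemma dotr_scale_gram m C (J : 'M[R]_(C, m)) (x : 'rV[R]_m) c :
  dotr ((c *: x) *m J^T) ((c *: x) *m J^T) = c ^+ 2 * qform (J^T *m J) x.
Proof. by rewrite qform_gram -scalemxAl dotrZl dotrZr mulrA expr2. Qed.

Lemma qform_rank1 m (H : 'M[R]_m) (x v : 'rV[R]_m) :
  qform (H^T *m (x^T *m x) *m H) v = (x *m H *m v^T) ord0 ord0 ^+ 2.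
Proof.
have -> : H^T *m (x^T *m x) *m H = (x *m H)^T *m (x *m H).
  by rewrite trmx_mul !mulmxA.
rewrite qform_gram /dotr big_ord1 -expr2; congr (_ ^+ 2).
have -> : v *m (x *m H)^T = (x *m H *m v^T)^T by rewrite [RHS]trmx_mul trmxK.
by rewrite mxE.
Qed.

End RankOneForms.

(** * Increments of a twice differentiable map and of its Jacobian *)

Section SecondOrder.
Context {R : realType} {m C : nat} (f : 'rV[R]_m -> 'rV[R]_C).
Hypothesis f2 : class_C2 f.
Local Notation mu := (@lebesgue_measure R).

Lemma jac_entry_continuous k a : continuous (fun w => jac f w k a).
Proof.
move=> w; apply: differentiable_continuous; apply: differentiable_entry.
by have [_ + _] := f2.
Qed.

Lemma diff_jac_entry_continuous v k a :
  continuous (fun w => 'd (jac f) w v k a).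
Proof.
have [_ _ c] := f2; move=> w.
apply: (@continuous_comp _ _ _ (fun w => 'd (jac f) w v) (fun N : 'M[R]_(C, m) => N
  k a)).
  exact: c.
exact: coord_continuous.
Qed.

Lemma hess_entry_continuous k a b :
  continuous (fun w => hess (fun x => f x ord0 k) w a b).
Proof.
have -> : (fun w => hess (fun x => f x ord0 k) w a b) =
          (fun w => 'd (jac f) w (delta_mx ord0 b) k a).
  by apply/funext => w; rewrite hessE.
exact: diff_jac_entry_continuous.
Qed.

Lemma hess_sym k w a b :
  hess (fun x => f x ord0 k) w a b = hess (fun x => f x ord0 k) w b a.
Proof.
have [df dJ cJ] := f2; rewrite !hessE//.
pose g x := f x ord0 k.
have gE c : (fun y => 'd g y (delta_mx ord0 c)) = (fun y => jac f y k c).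
  by apply/funext => y; rewrite jacE diff_entry.
have gE2 c c' : (fun y => 'd (fun z => 'd g z (delta_mx ord0 c)) y (delta_mx ord0 c'))
   = (fun y => 'd (jac f) y (delta_mx ord0 c') k c).
  by apply/funext => y; rewrite gE diff_entry.
have E c c' : 'd (jac f) w (delta_mx ord0 c') k c =
    'd (fun y => 'd g y (delta_mx ord0 c)) w (delta_mx ord0 c').
  by rewrite gE diff_entry.
rewrite !E; apply: diff_diffC.
- by move=> x; exact: differentiable_entry.
- by move=> x; rewrite gE; exact: differentiable_entry.
- by move=> x; rewrite gE; exact: differentiable_entry.
- by rewrite gE2; exact: diff_jac_entry_continuous.
- by rewrite gE2; exact: diff_jac_entry_continuous.
Qed.

(** Differentiating the Jacobian along [x] and applying it to [v] contracts the Hessian with [v]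
    first. Symmetry swaps the two, giving the form with [x] on the left that occurs in
    [hess_form]. *)
Lemma diff_jac_hess (w x v : 'rV[R]_m) k :
  (v *m ('d (jac f) w x)^T) ord0 k =
  (x *m hess (fun y => f y ord0 k) w *m v^T) ord0 ord0.
Proof.
rewrite !mxE; apply: eq_bigr => a _; rewrite !mxE mulrC; congr (_ * _).
rewrite {1}(row_sum_delta x) linear_sum /= summxE; apply: eq_bigr => b _.
by rewrite linearZ /= mxE hess_sym hessE.
Qed.

Lemma line_continuous (F : 'rV[R]_m -> R) (w v : 'rV[R]_m) :
  continuous F -> continuous (fun s : R => F (w + s *: v)).
Proof.
move=> cF s; apply: (@continuous_comp _ _ _ (fun s : R => w + s *: v) F);
  last exact: cF.
by apply: cvgD; [exact: cvg_cst|exact: scalel_continuous].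
Qed.

(** [increment_le_integral] for [f] along the segment of direction [sigma *: x]; the speed is linear
    in [sigma], hence the factor [sigma ^+ 2]. *)
Lemma C2_increment_le (w x : 'rV[R]_m) (sigma : R) :
  ((dotr (f (w + sigma *: x) - f w) (f (w + sigma *: x) - f w))%:E <=
   \int[mu]_(s in `[0%R, 1%R])
     (sigma ^+ 2 * qform ((jac f (w + (s * sigma) *: x))^T *m
                          jac f (w + (s * sigma) *: x)) x)%:E)%E.
Proof.
have [df dJ cJ] := f2.
pose g s := f (w + s *: (sigma *: x)).
pose dg s := (sigma *: x) *m (jac f (w + s *: (sigma *: x)))^T.
have -> : f (w + sigma *: x) - f w = g 1 - g 0 by rewrite /g scale1r scale0r addr0.
apply: le_trans (@increment_le_integral _ _ g dg _ _) _.
- move=> i s.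
  have := @is_derive_line _ _ _ (fun y => f y ord0 i) w (sigma *: x) s
    (differentiable_entry ord0 i (df _)).
  by rewrite diff_entry// diff_jac.
- move=> i; rewrite /dg.
  apply: (@line_continuous (fun y => (sigma *: x *m (jac f y)^T) ord0 i)).
  have -> : (fun y => (sigma *: x *m (jac f y)^T) ord0 i) =
            (fun y => dotr (sigma *: x) (row i (jac f y))).
    by apply/funext => y; rewrite mxE; apply: eq_bigr => j _; rewrite !mxE.
  apply: (@continuous_dotr _ _ _ (fun=> sigma *: x) (fun y => row i (jac f y))) => j.
    exact: cst_continuous.
  have -> : (fun y => row i (jac f y) ord0 j) = (fun y => jac f y i j).
    by apply/funext => y; rewrite mxE.
  exact: jac_entry_continuous.
rewrite le_eqVlt; apply/orP; left; apply/eqP; apply: eq_integral => s _; congr _%:E.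
by rewrite /dg scalerA dotr_scale_gram.
Qed.

(** The same argument for the curve of vectors [J v]. By [diff_jac_hess] its speed has components
    [sigma * (x H_k v)], whose squares are the rank-one forms on the right. *)
Lemma C2_jac_increment_le (w x v : 'rV[R]_m) (sigma : R) :
  ((dotr (v *m (jac f (w + sigma *: x) - jac f w)^T)
         (v *m (jac f (w + sigma *: x) - jac f w)^T))%:E <=
   \int[mu]_(s in `[0%R, 1%R])
     (sigma ^+ 2 * qform (\sum_(k < C)
        let H := hess (fun y => f y ord0 k) (w + (s * sigma) *: x) in
        H^T *m (x^T *m x) *m H) v)%:E)%E.
Proof.
have [df dJ cJ] := f2.
pose g s := v *m (jac f (w + s *: (sigma *: x)))^T.
pose dg s := v *m ('d (jac f) (w + s *: (sigma *: x)) (sigma *: x))^T.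
have -> : v *m (jac f (w + sigma *: x) - jac f w)^T = g 1 - g 0.
  by rewrite /g scale1r scale0r addr0 -mulmxBr linearB.
apply: le_trans (@increment_le_integral _ _ g dg _ _) _.
- move=> i s.
  have E (M : R -> 'M[R]_(C, m)) : (fun y => (v *m (M y)^T) ord0 i) =
      \sum_a (fun y => v ord0 a * M y i a).
    apply/funext => y; rewrite mxE fct_sumE; apply: eq_bigr => a _.
    by rewrite mxE.
  rewrite E /dg mxE; apply: is_derive_sum => a.
  have := @is_derive_line _ _ _ (fun y => jac f y i a) w (sigma *: x) s
    (differentiable_entry i a (dJ _)).
  rewrite diff_entry// => h; rewrite [X in _ * X]mxE.
  have hz := is_deriveZ (v ord0 a) h.
  exact hz.
- move=> i; rewrite /dg.
  apply: (@line_continuous (fun y => (v *m ('d (jac f) y (sigma *: x))^T) ord0 i)).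
  have -> : (fun y => (v *m ('d (jac f) y (sigma *: x))^T) ord0 i) =
            (fun y => dotr v (row i ('d (jac f) y (sigma *: x)))).
    by apply/funext => y; rewrite mxE; apply: eq_bigr => j _; rewrite !mxE.
  apply: (@continuous_dotr _ _ _ (fun=> v) (fun y => row i ('d (jac f) y (sigma *:
    x)))) => j.
    exact: cst_continuous.
  have -> : (fun y => row i ('d (jac f) y (sigma *: x)) ord0 j) =
            (fun y => 'd (jac f) y (sigma *: x) i j).
    by apply/funext => y; rewrite mxE.
  exact: diff_jac_entry_continuous.
rewrite le_eqVlt; apply/orP; left; apply/eqP; apply: eq_integral => s _; congr _%:E.
rewrite /dg linearZ /= linearZ /= -scalemxAr dotrZl dotrZr mulrA -expr2 scalerA.
congr (_ * _); rewrite /qform mulmx_sumr mulmx_suml summxE; apply: eq_bigr => k _.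
rewrite diff_jac_hess.
by rewrite -/(qform _ _) qform_rank1 expr2.
Qed.

End SecondOrder.

(** * Measurability and integration *)

Section MeasurableComposition.
Context {R : realType} {d : measure_display} {T : measurableType d}.

(* Open sets of [R^m] are countable unions of boxes with rational data. *)
Lemma measurable_fun_rV_comp m (g : 'rV[R]_m -> R) (X : T -> 'rV[R]_m) :
  continuous g -> (forall j, measurable_fun [set: T] (fun t => X t ord0 j)) ->
  measurable_fun [set: T] (fun t => g (X t)).
Proof.
move=> /continuousP cg mX.
apply: (measurability _ (RGenOpens.measurableE R)) => _ [_ [a [b ->] <-]].
rewrite setTI; pose O := g @^-1` `]a, b[%classic.
have oO : open O by apply/cg/interval_open.
rewrite -[X in measurable X]/(X @^-1` O).
pose box (p : 'rV[rat]_m * rat) : set 'rV[R]_m :=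
  [set x | forall j, x ord0 j \in `]ratr (p.1 ord0 j) - ratr p.2, ratr (p.1 ord0 j)
    + ratr p.2[].
have -> : X @^-1` O = \bigcup_(p : 'rV[rat]_m * rat)
    (if pselect (box p `<=` O) then X @^-1` (box p) else set0).
  apply/seteqP; split=> [t Ot|t [p _]]; last first.
    by case: pselect => // pO /pO.
  have /nbhs_ballP[e /= e0 eO] : nbhs (X t) O by apply: open_nbhs_nbhs; split.
  (* With [r < e / 2], a box of half-width [r] whose rational centre is within [r] of [X t] in each
     coordinate contains [X t] and stays in the ball of radius [e]. *)
  have [r] := rat_in_itvoo (divr_gt0 e0 (ltr0n R 2)).
  rewrite in_itv /= => /andP[r0 re].
  have /choice [q qP] (j : 'I_m) : exists q : rat,
      ratr q \in `](X t ord0 j - ratr r), (X t ord0 j + ratr r)[.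
    by apply: rat_in_itvoo; lra.
  exists (\row_j q j, r) => //=; case: pselect => /= [_ j|].
    by rewrite mxE; have := qP j; rewrite !in_itv /=; lra.
  case=> x bx; apply: eO; split => // i j; rewrite (ord1 i).
  have := bx j; have := qP j; rewrite /= mxE !in_itv /= /ball /= => /andP[? ?]
    /andP[? ?].
  by rewrite ltr_norml; apply/andP; split; lra.
apply: countable_bigcupT_measurable => [|p]; first exact: countableP.
case: (pselect (box p `<=` O)) => pO //=.
have -> : X @^-1` (box p) = \bigcap_(j in [set: 'I_m]) ((fun t => X t ord0 j) @^-1`
   `]ratr (p.1 ord0 j) - ratr p.2, ratr (p.1 ord0 j) + ratr p.2[%classic).
  apply/seteqP; split => [t bt j _|t bt j]; first exact: bt.
  exact: bt.
apply: fin_bigcap_measurable => [|j _]; first exact: finite_finset.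
by rewrite -[X in measurable X]setTI; apply: mX.
Qed.

End MeasurableComposition.

(** * Tonelli, Jensen, and linearity of matrix integrals *)

Section Integrals.
Context {R : realType} {d : measure_display} {T : measurableType d}.
Local Notation mu := (@lebesgue_measure R).

Lemma tonelli_itv01 (P : probability T R) (q : R -> T -> R) :
  (forall s t, 0 <= q s t) ->
  measurable_fun [set: measurableTypeR R * T] (fun p => q p.1 p.2) ->
  (\int[P]_t \int[mu]_(s in `[0%R, 1%R]) (q s t)%:E =
   \int[mu]_(s in `[0%R, 1%R]) \int[P]_t (q s t)%:E)%E.
Proof.
move=> q0 mq.
pose D : set (measurableTypeR R * T) := `[0%R, 1%R]%classic `*` setT.
(* Extension by zero outside the strip reduces the claim to Tonelli on the full product space. *)
pose F := (fun p : measurableTypeR R * T => (q p.1 p.2)%:E) \_ D.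
have FE s t : F (s, t) = (((fun s => (q s t)%:E) \_ `[0%R, 1%R]) s).
  rewrite /F /patch /D.
  have -> : ((s, t) \in `[0%R, 1%R]%classic `*` setT) = (s \in `[0%R, 1%R]%classic)
    by rewrite in_setX in_setT andbT.
  by [].
have mF : measurable_fun [set: measurableTypeR R * T] F.
  apply/(measurable_restrictT _ _).1; first by apply: measurableX.
  by apply: measurable_funTS; apply/measurable_EFinP.
have F0 p : (0 <= F p)%E.
  by rewrite /F /patch; case: ifP => // _; rewrite lee_fin.
have /= E := @fubini_tonelli _ _ (measurableTypeR R) T R mu P F mF F0.
transitivity (\int[P]_y \int[mu]_x F (x, y))%E.
  apply: eq_integral => t _; rewrite integral_mkcond; apply: eq_integral => s _.
  by rewrite FE.
rewrite -E [RHS]integral_mkcond; apply: eq_integral => s _; rewrite /patch;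
  case: ifPn => sI.
  by apply: eq_integral => t _; rewrite FE /patch sI.
by apply: integral0_eq => t _; rewrite FE /patch (negbTE sI).
Qed.

Lemma measurable_integral_itv01 (q : R -> T -> R) :
  (forall s t, 0 <= q s t) ->
  measurable_fun [set: measurableTypeR R * T] (fun p => q p.1 p.2) ->
  measurable_fun [set: T] (fun t => \int[mu]_(s in `[0%R, 1%R]) (q s t)%:E)%E.
Proof.
move=> q0 mq.
pose D : set (measurableTypeR R * T) := `[0%R, 1%R]%classic `*` setT.
pose F := (fun p : measurableTypeR R * T => (q p.1 p.2)%:E) \_ D.
have mF : measurable_fun [set: measurableTypeR R * T] F.
  apply/(measurable_restrictT _ _).1; first by apply: measurableX.
  by apply: measurable_funTS; apply/measurable_EFinP.
have F0 p : (0 <= F p)%E.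
  by rewrite /F /patch; case: ifP => // _; rewrite lee_fin.
have := @measurable_fun_fubini_tonelli_G _ _ (measurableTypeR R) T R mu F mF F0.
congr measurable_fun; apply/funext => t; rewrite /fubini_G [RHS]integral_mkcond.
apply: eq_integral => s _; rewrite /F /patch /D.
by rewrite in_setX in_setT andbT.
Qed.

Lemma integral_cst_sub (P : probability T R) (c : R) (g : T -> R) :
  P.-integrable [set: T] (EFin \o g) ->
  (\int[P]_t (c - g t)%:E = c%:E - \int[P]_t (g t)%:E)%E.
Proof.
move=> ig; have ic : P.-integrable [set: T] (EFin \o cst c).
  exact: finite_measure_integrable_cst.
transitivity (\int[P]_t ((EFin \o cst c) t - (EFin \o g) t))%E.
  by apply: eq_integral => t _; rewrite EFinB.
by rewrite (integralB measurableT ic ig) /= integral_cst//= probability_setT mule1.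
Qed.

(** Jensen for the square: with [c] the mean of [X], integrate [2 * c * X - c ^+ 2 <= X ^+ 2 <= Y].
    The majorant is extended-valued because it will be an integral over the segment, which may be
    infinite at some [t]. *)
Lemma sqr_Rintegral_le (P : probability T R) (X : T -> R) (Y : T -> \bar R) :
  P.-integrable [set: T] (EFin \o X) -> measurable_fun [set: T] Y ->
  (forall t, ((X t ^+ 2)%:E <= Y t)%E) ->
  (((\int[P]_t X t) ^+ 2)%:E <= \int[P]_t Y t)%E.
Proof.
move=> iX mY XY; have Y0 t : (0 <= Y t)%E.
  by apply: le_trans (XY t); rewrite lee_fin sqr_ge0.
have [->|Yoo] := eqVneq (\int[P]_t Y t)%E (+oo)%E; first by rewrite leey.
have iY : P.-integrable [set: T] Y.
  apply/integrableP; split => //.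
  under eq_integral do rewrite gee0_abs//.
  by rewrite ltey.
set c := \int[P]_t X t.
have ic : P.-integrable [set: T] (EFin \o cst (c ^+ 2)).
  exact: finite_measure_integrable_cst.
have iZ : P.-integrable [set: T] (EFin \o (fun t => 2 * c * X t)).
  have := integrableZl measurableT (2 * c) iX.
  by apply: eq_integrable.
have I1 : (\int[P]_t (2 * c * X t)%:E = (2 * c * c)%:E)%E.
  under eq_integral do rewrite EFinM.
  rewrite integralZl// -[X in (_ * X)%E]fineK; last exact: integrable_fin_num.
  by rewrite -EFinM.
have I2 : (\int[P]_t (c ^+ 2)%:E = (c ^+ 2)%:E)%E.
  by rewrite integral_cst//= probability_setT mule1.
have -> : (c ^+ 2)%:E = (\int[P]_t ((2 * c * X t)%:E - (c ^+ 2)%:E))%E.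
  rewrite (integralB measurableT iZ ic) /= I1 I2 -EFinB; congr _%:E; ring.
apply: le_integral => //.
  exact: (integrableB measurableT iZ ic).
move=> t _; apply: le_trans (XY t); rewrite -EFinB lee_fin.
by have := sqr_ge0 (X t - c); lra.
Qed.

Lemma integrable_dotr d' (T' : measurableType d') (nu : {measure set T' -> \bar R})
    (D : set T') k (M : T' -> 'rV[R]_k) (v : 'rV[R]_k) :
  measurable D -> mx_integrable nu D M ->
  nu.-integrable D (fun t => (dotr (M t) v)%:E).
Proof.
move=> mD iM.
have := @integrable_sum _ _ _ nu D mD _ (index_enum 'I_k) xpredT
  (fun j t => ((v ord0 j)%:E * (M t ord0 j)%:E)%E)
  (fun j _ => integrableZl mD (v ord0 j) (iM ord0 j)).
apply: eq_integrable => // t _; rewrite /= sumEFin; congr _%:E.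
by apply: eq_bigr => j _; rewrite mulrC.
Qed.

Lemma integral_dotr d' (T' : measurableType d') (nu : {measure set T' -> \bar R})
    (D : set T') k (M : T' -> 'rV[R]_k) (v : 'rV[R]_k) :
  measurable D -> mx_integrable nu D M ->
  (\int[nu]_(t in D) (dotr (M t) v)%:E = (dotr (mx_integral nu D M) v)%:E)%E.
Proof.
move=> mD iM; pose F j t := ((v ord0 j)%:E * (M t ord0 j)%:E)%E.
transitivity (\int[nu]_(t in D) \sum_j F j t)%E.
  apply: eq_integral => t _; rewrite sumEFin; congr _%:E.
  by apply: eq_bigr => j _; rewrite mulrC.
rewrite integral_sum//; last by move=> j; exact: integrableZl.
rewrite -sumEFin; apply: eq_bigr => j _.
rewrite integralZl// -[X in (_ * X)%E]fineK; last exact: integrable_fin_num.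
by rewrite -EFinM mxE mulrC.
Qed.

Lemma integral_qform d' (T' : measurableType d') (nu : {measure set T' -> \bar R})
    (D : set T') k (M : T' -> 'M[R]_k) (v : 'rV[R]_k) :
  measurable D -> mx_integrable nu D M ->
  (\int[nu]_(t in D) (qform (M t) v)%:E = (qform (mx_integral nu D M) v)%:E)%E.
Proof.
move=> mD iM.
under eq_integral do rewrite qformE.
have i1 i j : nu.-integrable D (fun t => (v ord0 i * M t i j * v ord0 j)%:E).
  have := integrableZl mD (v ord0 i * v ord0 j) (iM i j).
  apply: eq_integrable => // t _; rewrite -EFinM; congr _%:E; ring.
have i2 i : nu.-integrable D (fun t => (\sum_j v ord0 i * M t i j * v ord0 j)%:E).
  have := @integrable_sum _ _ _ nu D mD _ (index_enum 'I_k) xpredT _ (fun j _ => i1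
    i j).
  by apply: eq_integrable => // t _; rewrite sumEFin.
under eq_integral do rewrite -sumEFin.
rewrite integral_sum//= qformE -sumEFin; apply: eq_bigr => i _.
under eq_integral do rewrite -sumEFin.
rewrite integral_sum//= -sumEFin; apply: eq_bigr => j _.
rewrite mxE.
have -> : (\int[nu]_(t in D) (v ord0 i * M t i j * v ord0 j)%:E =
   \int[nu]_(t in D) ((v ord0 i * v ord0 j)%:E * (M t i j)%:E))%E.
  by apply: eq_integral => t _; rewrite -EFinM; congr _%:E; ring.
rewrite integralZl// -[X in (_ * X)%E](@fineK _ (\int[nu]_(t in D) (M t i
  j)%:E)%E); last first.
  exact: integrable_fin_num.
by rewrite -EFinM; congr _%:E; rewrite /Rintegral; ring.
Qed.

End Integrals.

(** * From suprema to selections *)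

Section RademacherSup.
Context {R : realType}.

(** The choices for different [e] are independent, so near-maximizers can be picked simultaneously
    and the bound on selections passes to the suprema. *)
Lemma sum_ereal_sup_le (I : finType) (A : I -> set R) (K : R) :
  (forall e, A e !=set0) ->
  (forall a : I -> R, (forall e, A e (a e)) -> \sum_e a e <= K) ->
  ((\sum_e ereal_sup (EFin @` A e))%E <= K%:E)%E.
Proof.
move=> /choice[a0 a0A] AK.
have ubA e : has_ubound (A e).
  (* Freezing the other entries at [a0] turns the bound on sums into an upper bound for each set, so
     the suprema are real numbers. *)
  exists (K - \sum_(e' | e' != e) a0 e') => x Ax; rewrite lerBrDr.
  pose a e' := if e' == e then x else a0 e'.
  have := AK a; rewrite (bigD1 e)//= /a eqxx => /(_ _)/wrap[].
    by move=> e'; case: eqP => [->|].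
  by rewrite (eq_bigr a0) // => e' /negbTE ->.
have supA e : has_sup (A e) by split => //; exists (a0 e).
rewrite (eq_bigr (fun e => (sup (A e))%:E)); last first.
  by move=> e _; rewrite ereal_sup_EFin//; exists (a0 e).
rewrite sumEFin lee_fin; apply/ler_addgt0Pr => x x0.
(* The tolerance [x] is shared among the indices; the added 1 keeps the denominator positive when
   [I] is empty. *)
pose y := x / (#|I|%:R + 1).
have N0 : 0 < #|I|%:R + 1 :> R by rewrite ltr_wpDl.
have y0 : 0 < y by rewrite divr_gt0.
have /choice[a aP] e : exists a, A e a /\ sup (A e) - y < a.
  by have [a Aa ya] := sup_adherent y0 (supA e); exists a.
apply: (@le_trans _ _ (\sum_e (a e + y))).
  by apply: ler_sum => e _; have [_] := aP e; lra.
rewrite big_split /= lerD//; first by apply: AK => e; have [] := aP e.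
rewrite sumr_const -[leLHS]mulr_natl -[leRHS](divfK (lt0r_neq0 N0)) -/y mulrC.
apply: ler_wpM2l; first exact: ltW.
by apply: (@le_trans _ _ #|I|%:R) => //; rewrite lerDl.
Qed.

Lemma rademacher_complexity_le (Z : Type) n (S : 'I_n -> Z) (F : set (Z -> R)) K :
  F !=set0 ->
  (forall f : {ffun 'I_n -> bool} -> Z -> R, (forall e, F (f e)) ->
     mean (fun e => \sum_i sgnb e i * f e (S i)) <= K) ->
  (rademacher_complexity S F <= (n%:R^-1 * K)%:E)%E.
Proof.
move=> [f0 Ff0] FK; rewrite /rademacher_complexity EFinM.
rewrite lee_wpmul2l// ?lee_fin ?invr_ge0//.
have c0 : 0 < (2 ^ n)%:R :> R by rewrite ltr0n expn_gt0.
rewrite lee_pdivrMl//  -EFinM.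
pose A (e : {ffun 'I_n -> bool}) : set R := [set \sum_(i < n) (-1) ^+ e i * f (S i)
  | f in F].
rewrite (eq_bigr (fun e => ereal_sup (EFin @` A e))); last first.
  by move=> e _; rewrite /A image_comp.
apply: sum_ereal_sup_le => [e|a aA]; first by exists (\sum_(i < n) (-1) ^+ e i * f0
  (S i)), f0.
have /choice[f fP] (e : {ffun 'I_n -> bool}) : exists f, F f /\ \sum_(i < n) (-1)
  ^+ e i * f (S i) = a e.
  by have [f Ff <-] := aA e; exists f.
have := FK f (fun e => (fP e).1).
rewrite /mean card_ffun card_bool card_ord ler_pdivrMl//; apply: le_trans.
by rewrite le_eqVlt; apply/orP; left; apply/eqP/eq_bigr => e _; rewrite -(fP e).2.
Qed.

End RademacherSup.

(** * The Jensen gap *)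

Section LossGradient.
Context {R : realType}.

(** The difference quotients in direction [x] are at most [l * enorm x], and the bound passes to the
    limit. *)
Lemma grad_lipschitz_le k (L : 'rV[R]_k -> R) (l : R) z x :
  lipschitz2_real l L -> differentiable L z -> dotr (grad L z) x <= l * enorm x.
Proof.
move=> lipL dL; rewrite -diff_grad -deriveE// /derive.
apply: limr_le; first exact: diff_derivable.
near=> h.
have h0 : h != 0 by near: h; exact: nbhs_dnbhs_neq.
rewrite /= -[_ *: _]/(_ * _); apply: le_trans (ler_norm _) _.
rewrite normrM normfV ler_pdivrMl ?normr_gt0//.
apply: le_trans (lipL _ _) _; rewrite addrK enormZ mulrCA //.
Unshelve. all: by end_near. Qed.

Lemma sqr_grad_lipschitz_le k (L : 'rV[R]_k -> R) (l : R) z x :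
  lipschitz2_real l L -> differentiable L z ->
  dotr (grad L z) x ^+ 2 <= l ^+ 2 * dotr x x.
Proof.
move=> lipL dL; rewrite -sqr_enorm -exprMn -[leLHS]real_normK ?num_real//.
have h : `|dotr (grad L z) x| <= l * enorm x.
  rewrite ler_norml (grad_lipschitz_le x lipL dL) andbT.
  have := grad_lipschitz_le (- x) lipL dL.
  rewrite -[- x]scaleN1r dotrZr enormZ normrN1 mul1r; lra.
by rewrite ler_pXn2r// nnegrE (le_trans _ h).
Qed.

(** Up to sign, the difference is [<g' - g, J v> + <g', (J' - J) v>]. The first term is controlled
    by Cauchy-Schwarz, the second by the hypothesis on [g']; the factor 2 comes from squaring a sum
    of two terms. *)
Lemma sqr_dotr_sub_le m C (g g' : 'rV[R]_C) (J J' : 'M[R]_(C, m)) v (l2 b2 K : R) :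
  (forall x, dotr g' x ^+ 2 <= l2 * dotr x x) ->
  dotr (g' - g) (g' - g) <= b2 * K ->
  (dotr g (v *m J^T) - dotr g' (v *m J'^T)) ^+ 2 <=
  2 * (b2 * qform (J^T *m J) v * K
       + l2 * dotr (v *m (J' - J)^T) (v *m (J' - J)^T)).
Proof.
move=> lg' gK; rewrite qform_gram.
have -> : v *m J'^T = v *m J^T + v *m (J' - J)^T.
  by rewrite -mulmxDr -linearD /= addrC subrK.
rewrite dotrDr; set x := v *m J^T; set y := v *m (J' - J)^T.
have h1 : dotr (g' - g) x ^+ 2 <= b2 * dotr x x * K.
  apply: le_trans (cauchy_schwarz _ _) _; rewrite mulrAC.
  by rewrite ler_wpM2r ?dotrr_ge0.
have h2 := lg' y; move: h1 h2; rewrite dotrDl dotrNl.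
have := sqr_ge0 (dotr g' x - dotr g x - dotr g' y).
set p := dotr g' x; set q := dotr g x; set r := dotr g' y => h1 h2 h3.
by rewrite [leLHS](_ : _ = (p - q + r) ^+ 2); [lra|ring].
Qed.

Lemma sqr_diff_grad_comp_le m C (L : 'rV[R]_C -> R) (f : 'rV[R]_m -> 'rV[R]_C)
    (l b : R) w w' v :
  lipschitz2_real l L -> smooth b L -> (forall x, differentiable f x) ->
  dotr (grad (L \o f) w - grad (L \o f) w') v ^+ 2 <=
  2 * (b ^+ 2 * qform ((jac f w)^T *m jac f w) v * dotr (f w' - f w) (f w' - f w)
     + l ^+ 2 * dotr (v *m (jac f w' - jac f w)^T) (v *m (jac f w' - jac f w)^T)).
Proof.
move=> lipL [dL bL] df.
have sub2 (x x' y y' K : R) : x = x' -> y = y' -> (x' - y') ^+ 2 <= K -> (x - y) ^+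
  2 <= K.
  by move=> -> ->.
rewrite dotrDl dotrNl.
apply: (sub2 _ _ _ _ _ (diff_comp_jac v (df w) (dL _)) (diff_comp_jac v (df w') (dL
  _))).
apply: sqr_dotr_sub_le.
  by move=> x; exact: sqr_grad_lipschitz_le.
rewrite -!sqr_enorm -exprMn.
by rewrite ler_pXn2r ?nnegrE ?enorm_ge0 ?(le_trans _ (bL _ _)) ?enorm_ge0.
Qed.

End LossGradient.

(** * Directional derivatives of the gap *)

Section GapGradient.
Context {R : realType} {d : measure_display} {T : measurableType d}.
Context (P : probability T R) (m C : nat) (u : T -> 'rV[R]_m) (sigma : R).
Hypothesis mu_u : forall j, measurable_fun [set: T] (fun t => u t ord0 j).
Context (f : 'rV[R]_m -> 'rV[R]_C) (f2 : class_C2 f).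
Local Notation mu := (@lebesgue_measure R).

Lemma jac_formE w s t : jac_form u sigma f w s t =
  qform ((jac f (w + (s * sigma) *: u t))^T *m jac f (w + (s * sigma) *: u t)) (u t).
Proof. by []. Qed.

Lemma jac_form_ge0 w s t : 0 <= jac_form u sigma f w s t.
Proof. by rewrite jac_formE qform_gram dotrr_ge0. Qed.

Lemma qform_hess_formE w v s t : qform (hess_form u sigma f w s t) v =
  \sum_(k < C) (u t *m hess (fun x => f x ord0 k) (w + (s * sigma) *: u t)
                 *m v^T) ord0 ord0 ^+ 2.
Proof.
rewrite /hess_form {1}/qform mulmx_sumr mulmx_suml summxE.
by apply: eq_bigr => k _; rewrite -qform_rank1.
Qed.

Lemma qform_hess_form_ge0 w v s t : 0 <= qform (hess_form u sigma f w s t) v.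
Proof. by rewrite qform_hess_formE sumr_ge0// => k _; rewrite sqr_ge0. Qed.

Lemma measurable_shift_comp w (g : 'rV[R]_m -> R) : continuous g ->
  measurable_fun [set: measurableTypeR R * T]
    (fun p => g (w + (p.1 * sigma) *: u p.2)).
Proof.
move=> cg; apply: (measurable_fun_rV_comp (X := fun p : measurableTypeR R * T =>
   w + (p.1 * sigma) *: u p.2)) => // j.
have -> : (fun p : measurableTypeR R * T => (w + (p.1 * sigma) *: u p.2) ord0 j) =
   (fun p : measurableTypeR R * T => w ord0 j + p.1 * sigma * u p.2 ord0 j).
  by apply/funext => p; rewrite !mxE.
apply: measurable_funD => //; apply: measurable_funM.
  by apply: measurable_funM.
by apply: (measurableT_comp (mu_u j)); exact: measurable_snd.
Qed.

Lemma measurable_u_snd j :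
  measurable_fun [set: measurableTypeR R * T] (fun p => u p.2 ord0 j).
Proof. by apply: (measurableT_comp (mu_u j)); exact: measurable_snd. Qed.

Lemma measurable_jac_form w : measurable_fun [set: measurableTypeR R * T]
  (fun p => jac_form u sigma f w p.1 p.2).
Proof.
have -> : (fun p : measurableTypeR R * T => jac_form u sigma f w p.1 p.2) =
    (fun p : measurableTypeR R * T => \sum_k (\sum_a u p.2 ord0 a *
       jac f (w + (p.1 * sigma) *: u p.2) k a) ^+ 2).
  apply/funext => p; rewrite jac_formE qform_gram; apply: eq_bigr => k _.
  rewrite -expr2; congr (_ ^+ 2); rewrite mxE; apply: eq_bigr => a _.
  by rewrite mxE.
apply: measurable_sum => k; apply: measurable_funX; apply: measurable_sum => a.
apply: measurable_funM; first exact: measurable_u_snd.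
apply: (measurable_shift_comp w (g := fun y => jac f y k a)).
exact: jac_entry_continuous.
Qed.

Lemma measurable_qform_hess_form w v :
  measurable_fun [set: measurableTypeR R * T]
    (fun p => qform (hess_form u sigma f w p.1 p.2) v).
Proof.
have -> : (fun p : measurableTypeR R * T => qform (hess_form u sigma f w p.1 p.2) v) =
    (fun p : measurableTypeR R * T => \sum_k (\sum_b (\sum_a u p.2 ord0 a *
       hess (fun x => f x ord0 k) (w + (p.1 * sigma) *: u p.2) a b) * v ord0 b) ^+ 2).
  apply/funext => p; rewrite qform_hess_formE; apply: eq_bigr => k _.
  congr (_ ^+ 2); rewrite mxE; apply: eq_bigr => b _; rewrite !mxE.
  by congr (_ * _); apply: eq_bigr.
apply: measurable_sum => k; apply: measurable_funX; apply: measurable_sum => b.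
apply: measurable_funM => //; apply: measurable_sum => a.
apply: measurable_funM; first exact: measurable_u_snd.
apply: (measurable_shift_comp w (g := fun y => hess (fun x => f x ord0 k) y a b)).
exact: hess_entry_continuous.
Qed.

Lemma integral_itv01Zl (c : R) (q : R -> T -> R) t : 0 <= c ->
  (forall s t, 0 <= q s t) ->
  measurable_fun [set: measurableTypeR R * T] (fun p => q p.1 p.2) ->
  (\int[mu]_(s in `[0%R, 1%R]) (c * q s t)%:E =
   c%:E * \int[mu]_(s in `[0%R, 1%R]) (q s t)%:E)%E.
Proof.
move=> c0 q0 mq; under eq_integral do rewrite EFinM.
rewrite ge0_integralZl_EFin//; first by move=> s _; rewrite lee_fin.
apply/measurable_EFinP; apply: measurable_funTS.
exact: (@measurableT_comp _ _ _ _ _ _ (fun p : measurableTypeR R * T => q p.1 p.2)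
  setT (fun s => (s, t))).
Qed.

Context (L : 'rV[R]_C -> R) (l b : R) (G B : 'M[R]_m) (A : R).
Hypotheses (lipL : lipschitz2_real l L) (smL : smooth b L).

(** The 2 in the matrix comes from [sqr_dotr_sub_le] and [sigma ^+ 2] from the two increment bounds.
    Jensen is applied to the mean over [u], and Tonelli then restores the order of integration used
    in the definitions of [A] and [B]. *)
Lemma sqr_grad_jensen_gap_le w v :
  differentiable_under_expectation P u sigma (fun x => L (f x)) w ->
  loewner_le ((jac f w)^T *m jac f w) G ->
  ((\int[mu]_(s in `[0%R, 1%R]) 'E_P[jac_form u sigma f w s]) <= A%:E)%E ->
  (forall s, `[0, 1]%classic s -> mx_integrable P [set: T] (hess_form u sigma f w s)) ->
  (let M := fun s => mx_integral P [set: T] (hess_form u sigma f w s) in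
     mx_integrable mu `[0, 1] M /\ loewner_le (mx_integral mu `[0, 1] M) B) ->
  'd (fun x => L (f x) - smoothed P u sigma (fun y => L (f y)) x) w v ^+ 2 <=
  qform ((2 * sigma ^+ 2) *: ((b ^+ 2 * A) *: G + l ^+ 2 *: B)) v.
Proof.
move=> [iF dF iG gE] [_ JG] intA iH [iM [_ MB]].
have df x : differentiable f x by have [] := f2.
have dL x : differentiable L x by have [] := smL.
have dLf : differentiable (fun x => L (f x)) w.
  exact: (@differentiable_comp _ _ _ _ f L).
pose X t := dotr (grad (L \o f) w - grad (L \o f) (w + sigma *: u t)) v.
have iDot : P.-integrable [set: T] (EFin \o (fun t => dotr (grad (L \o f) (w +
  sigma *: u t)) v)).
  exact: integrable_dotr.
have icst (c : R) : P.-integrable [set: T] (EFin \o cst c).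
  exact: finite_measure_integrable_cst.
have iX : P.-integrable [set: T] (EFin \o X).
  have := integrableB measurableT (icst (dotr (grad (L \o f) w) v)) iDot.
  by apply: eq_integrable => // t _; rewrite /X /= dotrDl dotrNl EFinB.
(* Differentiation under the expectation; the deterministic gradient at [w] enters the integral
   because [P] has mass 1. *)
have dE : 'd (fun x => L (f x) - smoothed P u sigma (fun y => L (f y)) x) w v =
    \int[P]_t X t.
  rewrite (@diffB _ _ _ (fun x => L (f x)) (smoothed P u sigma (fun y => L (f y))))//=.
  rewrite !diff_grad gE.
  rewrite -[LHS]/(fine (_ - _)%:E) EFinB -integral_dotr//; congr fine.
  apply: (etrans (esym (integral_cst_sub _ iDot))).
  by apply: eq_integral => t _; rewrite /X dotrDl dotrNl.
rewrite dE.
pose Q1 t := (\int[mu]_(s in `[0%R, 1%R]) (jac_form u sigma f w s t)%:E)%E.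
pose Q2 t := (\int[mu]_(s in `[0%R, 1%R]) (qform (hess_form u sigma f w s t) v)%:E)%E.
have Q10 t : (0 <= Q1 t)%E.
  by apply: integral_ge0 => s _; rewrite lee_fin jac_form_ge0.
have Q20 t : (0 <= Q2 t)%E.
  by apply: integral_ge0 => s _; rewrite lee_fin qform_hess_form_ge0.
have mQ1 : measurable_fun [set: T] Q1.
  by apply: measurable_integral_itv01 => [s t|];
    [exact: jac_form_ge0|exact: measurable_jac_form].
have mQ2 : measurable_fun [set: T] Q2.
  by apply: measurable_integral_itv01 => [s t|];
    [exact: qform_hess_form_ge0|exact: measurable_qform_hess_form].
have G0 : 0 <= qform G v.
  have := JG v; rewrite -/(qform _ _) qformB => h.
  have := dotrr_ge0 (v *m (jac f w)^T); rewrite -qform_gram; lra.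
pose c1 := 2 * (b ^+ 2 * qform G v) * sigma ^+ 2.
pose c2 := 2 * l ^+ 2 * sigma ^+ 2.
have c10 : 0 <= c1 by rewrite mulr_ge0 ?sqr_ge0// mulr_ge0// mulr_ge0 ?sqr_ge0.
have c20 : 0 <= c2 by rewrite mulr_ge0 ?sqr_ge0// mulr_ge0 ?sqr_ge0.
(* Pointwise in [u], the increments of [f] and of its Jacobian are bounded by segment integrals, and
   the Gram matrix of the Jacobian at [w] by [G]. *)
have pt t : ((X t ^+ 2)%:E <= c1%:E * Q1 t + c2%:E * Q2 t)%E.
  set D1 := dotr (f (w + sigma *: u t) - f w) (f (w + sigma *: u t) - f w).
  set D2 := dotr (v *m (jac f (w + sigma *: u t) - jac f w)^T)
                 (v *m (jac f (w + sigma *: u t) - jac f w)^T).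
  have h1 : (D1%:E <= (sigma ^+ 2)%:E * Q1 t)%E.
    rewrite -(@integral_itv01Zl _ (jac_form u sigma f w)
      t (sqr_ge0 sigma) (jac_form_ge0 w) (measurable_jac_form w)).
    exact: C2_increment_le.
  have h2 : (D2%:E <= (sigma ^+ 2)%:E * Q2 t)%E.
    rewrite -(@integral_itv01Zl _ (fun s t => qform (hess_form u sigma f w s t) v)
      t (sqr_ge0 sigma) (qform_hess_form_ge0 w v) (measurable_qform_hess_form w v)).
    exact: C2_jac_increment_le.
  apply: (@le_trans _ _ (((2 * (b ^+ 2 * qform G v))%:E * D1%:E) + (2 * l ^+ 2)%:E
    * D2%:E)%E).
    rewrite -!EFinM -EFinD lee_fin /X.
    apply: le_trans (sqr_diff_grad_comp_le w (w + sigma *: u t) v lipL smL df) _.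
    rewrite -/D1 -/D2.
    have GJ : 0 <= qform G v - qform ((jac f w)^T *m jac f w) v.
      by have := JG v; rewrite -/(qform _ _) qformB.
    have D10 : 0 <= D1 by exact: dotrr_ge0.
    by have := mulr_ge0 (mulr_ge0 (sqr_ge0 b) D10) GJ; lra.
  rewrite /c1 /c2 !(EFinM _ (sigma ^+ 2)) -!muleA.
  apply: leeD; apply: lee_wpmul2l => //; rewrite lee_fin; apply: mulr_ge0 => //.
    by apply: mulr_ge0 => //; exact: sqr_ge0.
  exact: sqr_ge0.
have := @sqr_Rintegral_le _ _ _ P X _ iX _ pt => /(_ _)/wrap[].
  by apply: emeasurable_funD; apply: measurable_funeM.
rewrite ge0_integralD//; last 4 first.
- by move=> t _; rewrite mule_ge0.
- exact: measurable_funeM.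
- by move=> t _; rewrite mule_ge0.
- exact: measurable_funeM.
rewrite !ge0_integralZl_EFin// => main.
rewrite -lee_fin; apply: le_trans main _.
have I1 : (\int[P]_t Q1 t <= A%:E)%E.
  rewrite (tonelli_itv01 P (jac_form_ge0 w) (measurable_jac_form w)).
  by apply: le_trans intA; under [leRHS]eq_integral do rewrite unlock.
(* A quadratic form at fixed [v] is linear in its matrix, so it commutes with both integrals and the
   Loewner bound by [B] can be evaluated at [v]. *)
have I2 : (\int[P]_t Q2 t <= (qform B v)%:E)%E.
  rewrite (tonelli_itv01 P (qform_hess_form_ge0 w v) (measurable_qform_hess_form w v)).
  have -> : (\int[mu]_(s in `[0%R, 1%R]) \int[P]_t (qform (hess_form u sigma f w s
    t) v)%:E =
      \int[mu]_(s in `[0%R, 1%R])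
         (qform (mx_integral P setT (hess_form u sigma f w s)) v)%:E)%E.
    apply: eq_integral => s; rewrite inE => s01; apply: integral_qform => //; exact: iH.
  rewrite integral_qform// lee_fin.
  by have := MB v; rewrite -/(qform _ _) qformB; lra.
apply: (@le_trans _ _ (c1%:E * A%:E + c2%:E * (qform B v)%:E)%E).
  by apply: leeD; apply: lee_wpmul2l.
rewrite -!EFinM -EFinD lee_fin qformZ qformD !qformZ /c1 /c2.
by rewrite le_eqVlt; apply/orP; left; apply/eqP; ring.
Qed.

End GapGradient.

(** * From derivative bounds to increments on the ball *)

Section Segment.
Context {R : realType}.

Lemma eball_segment m (rho : R) (v w : 'rV[R]_m) c :
  eball rho v -> eball rho w -> 0 <= c <= 1 -> eball rho (w + c *: (v - w)).
Proof.
rewrite /eball /= => hv hw /andP[c0 c1].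
have -> : w + c *: (v - w) = (1 - c) *: w + c *: v.
  by rewrite scalerBr scalerBl scale1r addrCA addrC.
apply: le_trans (enorm_tri _ _) _; rewrite !enormZ !ger0_norm ?subr_ge0//.
nra.
Qed.

(** Mean value theorem on the segment from [w] to [v]. Differentiability is given on the ball only,
    and convexity keeps the segment inside. *)
Lemma sqr_increment_le m (rho : R) (phi : 'rV[R]_m -> R) (A : 'M[R]_m) v w :
  (forall x, eball rho x -> differentiable phi x) ->
  (forall x z, eball rho x -> 'd phi x z ^+ 2 <= qform A z) ->
  eball rho v -> eball rho w -> (phi v - phi w) ^+ 2 <= qform A (v - w).
Proof.
move=> dphi bphi hv hw.
have seg c : 0 <= c <= 1 -> eball rho (w + c *: (v - w)) by exact: eball_segment.
have [||c] := @MVT_segment R (fun x => phi (w + x *: (v - w)))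
    (fun x => 'd phi (w + x *: (v - w)) (v - w)) 0 1 ler01.
- move=> x; rewrite in_itv /= => /andP[x0 x1]; apply: is_derive_line.
  by apply/dphi/seg; rewrite !ltW.
- apply: derivable_within_continuous => x; rewrite in_itv /= => x01.
  exact: (@ex_derive _ _ _ _ _ _ _ (is_derive_line (dphi _ (seg _ x01)))).
rewrite in_itv /= => c01; rewrite scale1r scale0r addr0 subr0 mulr1 (addrC w) subrK
  => ->.
exact/bphi/seg.
Qed.

End Segment.

Theorem corollary7p6 (R : realType) :
  exists c : R, 0 < c /\
  forall (X Y : Type) (n m C : nat) (S : 'I_n -> X * Y)
    (h : 'rV[R]_m -> X -> 'rV[R]_C) (L : 'rV[R]_C -> Y -> R)
    (rho sigma l b : R)
    (d : measure_display) (T : measurableType d) (P : probability T R)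
    (u : T -> 'rV[R]_m)
    (G B : 'I_n -> 'M[R]_m),
  let Theta := @eball R m rho in
  let hS := fun i (w : 'rV[R]_m) => h w (S i).1 in
  let A := fun i => jac_sup P u sigma (hS i) Theta in
  let JS := n%:R^-1 * \sum_(i < n) fine (A i) * \tr (G i) in
  let HS := n%:R^-1 * \sum_(i < n) \tr (B i) in
  (0 < n)%N -> 0 <= rho -> 0 < sigma ->
  std_gaussian P u ->
  (forall y, [/\ forall z, differentiable (fun z => L z y) z,
                 lipschitz2_real l (fun z => L z y) &
                 smooth b (fun z => L z y)]) ->
  (forall i, class_C2 (hS i)) ->
  (forall i w, Theta w ->
     differentiable_under_expectation P u sigma
       (fun w' => L (hS i w') (S i).2) w) ->
  (forall i w s, Theta w -> `[0, 1]%classic s ->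
     P.-integrable [set: T] (fun t => (jac_form u sigma (hS i) w s t)%:E) /\
     mx_integrable P [set: T] (hess_form u sigma (hS i) w s)) ->
  (forall i, psd (G i)) ->
  (forall i w, Theta w ->
     loewner_le ((jac (hS i) w)^T *m jac (hS i) w) (G i)) ->
  (forall i, (A i < +oo)%E) ->
  (forall i, psd (B i)) ->
  (forall i w, Theta w ->
     let M := fun s => mx_integral P [set: T] (hess_form u sigma (hS i) w s) in
     mx_integrable lebesgue_measure `[0, 1] M /\
     loewner_le (mx_integral lebesgue_measure `[0, 1] M) (B i)) ->
  (rademacher_complexity S (jensen_gap_class P u sigma h L Theta) <=
   (c * (rho * sigma / Num.sqrt n%:R)
      * Num.sqrt (b ^+ 2 * JS + l ^+ 2 * HS))%:E)%E.
Proof.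
(* The 2 is the factor in [rademacher_selection]; [Num.sqrt 2] comes from the factor 2 in the
   matrices [Sig i] below. *)
exists (2 * Num.sqrt 2); split; first by rewrite mulr_gt0// sqrtr_gt0.
move=> X Y n m C S h L rho sigma l b d T P u G B Theta hS A JS HS n0 rho0 sigma0.
move=> [mu_u _] HL C2h dexp intH psdG JG Aoo psdB HB.
(* The origin witnesses that the class is nonempty and that each supremum [A i] is nonnegative, so
   finiteness of [A i] makes [fine (A i)] faithful. *)
have Theta0 : Theta 0 by rewrite /Theta /eball /= enormE dotrE mul0mx mxE sqrtr0.
have Age i w : Theta w ->
    ((\int[lebesgue_measure]_(s in `[0%R, 1%R]) 'E_P[jac_form u sigma (hS i) w s])
      <= A i)%E.
  by move=> Tw; apply: ereal_sup_ubound; exists w.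
have A0 i : (0 <= A i)%E.
  apply: le_trans (Age i 0 Theta0); apply: integral_ge0 => s _.
  by apply: expectation_ge0 => t; exact: jac_form_ge0.
have AE i : A i = (fine (A i))%:E by rewrite fineK// ge0_fin_numE.
pose phi i w := L (hS i w) (S i).2 - smoothed P u sigma (fun w' => L (hS i w') (S
  i).2) w.
pose Sig i := (2 * sigma ^+ 2) *: ((b ^+ 2 * fine (A i)) *: G i + l ^+ 2 *: B i).
have psdSig i : psd (Sig i).
  apply: psdZ; first by rewrite mulr_ge0 ?sqr_ge0.
  apply: psdD; apply: psdZ => //; last exact: sqr_ge0.
  by apply: mulr_ge0; [exact: sqr_ge0|exact: fine_ge0].
have dphi i w : Theta w -> differentiable (phi i) w.
  move=> Tw; have [_ dF _ _] := dexp i w Tw; apply: differentiableB => //.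
  apply: (@differentiable_comp _ _ _ _ (hS i) (fun z => L z (S i).2)).
    by have [] := C2h i.
  by have [] := HL (S i).2.
have lip i v w : Theta v -> Theta w -> (phi i v - phi i w) ^+ 2 <= qform (Sig i) (v
  - w).
  apply: sqr_increment_le => [x Tx|x z Tx]; first exact: dphi.
  have [_ lipL smL] := HL (S i).2.
  apply: (@sqr_grad_jensen_gap_le _ _ _ P m C u sigma mu_u (hS i) (C2h i)
    (fun z => L z (S i).2) l b (G i) (B i) (fine (A i)) lipL smL x z (dexp i x Tx)
    (JG i x Tx) _ _ (HB i x Tx)).
  - by rewrite -AE; exact: Age.
  - by move=> s s01; have [] := intH i x s Tx s01.
apply: le_trans (rademacher_complexity_le (K := 2 * rho * Num.sqrt (\sum_i \tr (Sig
  i))) _ _) _.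
- by exists (fun p => L (h 0 p.1) p.2 - smoothed P u sigma (fun w' => L (h w' p.1)
  p.2) 0), 0.
- move=> g Fg; have /choice[w wP] e : exists w, Theta w /\
      (fun p : X * Y => L (h w p.1) p.2 - smoothed P u sigma (fun w' => L (h w'
        p.1) p.2) w) = g e.
    by have [w Tw <-] := Fg e; exists w.
  have := @rademacher_selection _ n m rho phi Sig w rho0 psdSig (fun e => (wP e).1) lip.
  apply: le_trans; rewrite le_eqVlt; apply/orP; left; apply/eqP/eq_mean => e.
  by apply: eq_bigr => i _; rewrite -(wP e).2.
rewrite lee_fin.
(* [JS] and [HS] are averages, so the total trace carries a factor [n]; its square root against the
   [n^-1] of the complexity leaves the rate [1 / sqrt n]. *)
have trE : \sum_i \tr (Sig i) = 2 * sigma ^+ 2 * (n%:R * (b ^+ 2 * JS + l ^+ 2 * HS)).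
  have nn0 : n%:R != 0 :> R by rewrite pnatr_eq0 -lt0n.
  have -> : n%:R * (b ^+ 2 * JS + l ^+ 2 * HS) =
      b ^+ 2 * \sum_(i < n) fine (A i) * \tr (G i) + l ^+ 2 * \sum_(i < n) \tr (B i).
    by rewrite /JS /HS; field.
  rewrite !mulr_sumr -big_split mulr_sumr /=; apply: eq_bigr => i _.
  by rewrite /Sig mxtraceZ mxtraceD !mxtraceZ; ring.
have s0 : 0 < Num.sqrt n%:R :> R by rewrite sqrtr_gt0 ltr0n.
have nE : n%:R = Num.sqrt n%:R ^+ 2 :> R by rewrite sqr_sqrtr.
have c0 : 0 <= 2 * sigma ^+ 2 by apply: mulr_ge0 => //; exact: sqr_ge0.
rewrite trE (sqrtrM _ c0) (@sqrtrM _ 2)// sqrtr_sqr (gtr0_norm sigma0) (@sqrtrM _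
  n%:R)//.
rewrite le_eqVlt; apply/orP; left; apply/eqP.
rewrite {1}nE; field; exact: lt0r_neq0.
Qed.
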